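(* Consider the stochastic stationary optimization problem $$\min_{\bar X\in\mathcal L^2(\mathbb R^{n_x}),\,\bar U\in\mathcal L^2(\mathbb R^{n_u})}\ \|\bar X\|_Q^2+\|\bar U\|_R^2\quad\text{s.t. } \bar X \text{ and } A\bar X+B\bar U+EW' \text{ have the same distribution},$$ where $W'$ has the law of $W$ and is independent of $(\bar X,\bar U)$. Let $(\bar\mu_X^\star,\bar\mu_U^\star)$ be the probability measure of its solutions. Then $(\bar\mu_X^\star,\bar\mu_U^\star)$ is uniquely determined and equals $(\mu_X^\diamond,\mu_U^\diamond)$, and the minimum cost is $$\|W\|_{E^\top PE}^2+\|\mathbb E[W]\|_{\Delta\bar S}^2,\qquad \Delta\bar S=E^\top G+G^\top E-F^\top(R+B^\top PB)F.$$
   Context: $A\in\mathbb R^{n_x\times n_x}$, $B\in\mathbb R^{n_x\times n_u}$, $E\in\mathbb R^{n_x\times n_w}$; $Q\succeq0$, $R\succ0$; $(A,B)$ stabilizable, $(A,Q^{1/2})$ detectable. $W$ is a square-integrable random vector in $\mathbb R^{n_w}$ (the disturbance law). For symmetric $M$, $\|Z\|_M^2=\mathbb E[Z^\top MZ]$ (for deterministic $z$, $z^\top Mz$). Stationary quantities: $P$ stabilizing positive semidefinite solution of $P=Q+A^\top(P-PB(R+B^\top PB)^{-1}B^\top P)A$; $K=-(R+B^\top PB)^{-1}B^\top PA$; $\tilde A=A+BK$ (Schur stable); $G$ the unique solution of $G=\tilde A^\top(PE+G)$; $F=-(R+B^\top PB)^{-1}B^\top(PE+G)$; $\tilde F=BF+E$.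 $\mu_X^\diamond$ is the law of $X_\infty:=(I-\tilde A)^{-1}\tilde F\mathbb E[W]+\sum_{j=0}^\infty\tilde A^jE(W_j-\mathbb E[W])$ with $W_j$ i.i.d. copies of $W$, and $\mu_U^\diamond$ is the law of $KX_\infty+F\mathbb E[W]$; $(\mu_X^\diamond,\mu_U^\diamond)$ is the limit of the laws of the overtakingly optimal trajectory of the infinite-horizon stochastic LQ problem with dynamics $X_{k+1}=AX_k+BU_k+EW_k$. *)

(* Defs.v *)
From mathcomp Require Import all_boot all_algebra all_classical all_reals all_analysis.
From mathcomp Require Import complex.
Import GRing.Theory Num.Theory numFieldNormedType.Exports.
Set Implicit Arguments. Unset Strict Implicit. Unset Printing Implicit Defensive.
Local Open Scope classical_set_scope.
Local Open Scope ring_scope.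

Section LQDefs.
Variable R : realType.

Definition qform n (M : 'M[R]_n) (z : 'cV[R]_n) : R := (z^T *m M *m z) 0 0.

Definition psd n (M : 'M[R]_n) : Prop :=
  M^T = M /\ forall z : 'cV[R]_n, 0 <= qform M z.
Definition pd n (M : 'M[R]_n) : Prop :=
  M^T = M /\ forall z : 'cV[R]_n, z != 0 -> 0 < qform M z.

Definition schur_stable n (M : 'M[R]_n) : Prop :=
  forall (z : R[i]) (v : 'cV[R[i]]_n), v != 0 ->
    map_mx (fun x : R => (x%:C)%C) M *m v = z *: v -> `|z| < 1.

Definition stabilizable nx nu (A : 'M[R]_nx) (B : 'M[R]_(nx, nu)) : Prop :=
  exists K0 : 'M[R]_(nu, nx), schur_stable (A + B *m K0).

Definition detectable nx p (A : 'M[R]_nx) (C : 'M[R]_(p, nx)) : Prop :=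
  exists L : 'M[R]_(nx, p), schur_stable (A + L *m C).

(* (A, Q^{1/2}) detectable, Q^{1/2} being the (unique) psd square root of Q *)
Definition detectable_sqrt nx (A Q : 'M[R]_nx) : Prop :=
  exists C : 'M[R]_nx, psd C /\ C *m C = Q /\ detectable A C.

Definition lqK nx nu (A : 'M[R]_nx) (B : 'M[R]_(nx, nu)) (Rm : 'M[R]_nu)
  (P : 'M[R]_nx) : 'M[R]_(nu, nx) :=
  - (invmx (Rm + B^T *m P *m B) *m B^T *m P *m A).

Definition dare nx nu (A : 'M[R]_nx) (B : 'M[R]_(nx, nu)) (Q : 'M[R]_nx)
  (Rm : 'M[R]_nu) (P : 'M[R]_nx) : Prop :=
  P = Q + A^T *m (P - P *m B *m invmx (Rm + B^T *m P *m B) *m B^T *m P) *m A.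

Definition stabilizing_dare_sol nx nu (A : 'M[R]_nx) (B : 'M[R]_(nx, nu))
  (Q : 'M[R]_nx) (Rm : 'M[R]_nu) (P : 'M[R]_nx) : Prop :=
  psd P /\ dare A B Q Rm P /\ schur_stable (A + B *m lqK A B Rm P).

Definition lqF nx nu nw (B : 'M[R]_(nx, nu)) (E : 'M[R]_(nx, nw)) (Rm : 'M[R]_nu)
  (P : 'M[R]_nx) (G : 'M[R]_(nx, nw)) : 'M[R]_(nu, nw) :=
  - (invmx (Rm + B^T *m P *m B) *m B^T *m (P *m E + G)).

Definition deltaS nx nu nw (B : 'M[R]_(nx, nu)) (E : 'M[R]_(nx, nw)) (Rm : 'M[R]_nu)
  (P : 'M[R]_nx) (G : 'M[R]_(nx, nw)) : 'M[R]_nw :=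
  E^T *m G + G^T *m E
  - (lqF B E Rm P G)^T *m (Rm + B^T *m P *m B) *m lqF B E Rm P G.

Definition mxBorel n : set (set 'cV[R]_n) :=
  <<s [set S | exists (i : 'I_n) (A : set R), measurable A /\
                 S = (fun v : 'cV[R]_n => v i 0) @^-1` A] >>.

Definition random_vec d (T : measurableType d) (Pr : probability T R) n
  (X : T -> 'cV[R]_n) : Prop :=
  forall i : 'I_n, measurable_fun setT (fun w => X w i 0).

Definition L2vec d (T : measurableType d) (Pr : probability T R) n
  (X : T -> 'cV[R]_n) : Prop :=
  random_vec Pr X /\
  forall i : 'I_n, Pr.-integrable setT (fun w => ((X w i 0) ^+ 2)%:E).

Definition same_law d1 (T1 : measurableType d1) (Pr1 : probability T1 R)
  d2 (T2 : measurableType d2) (Pr2 : probability T2 R) n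
  (X : T1 -> 'cV[R]_n) (Y : T2 -> 'cV[R]_n) : Prop :=
  forall S, mxBorel S -> Pr1 (X @^-1` S) = Pr2 (Y @^-1` S).

Definition indep_vec d (T : measurableType d) (Pr : probability T R) n m
  (Y : T -> 'cV[R]_n) (Z : T -> 'cV[R]_m) : Prop :=
  forall S S', mxBorel S -> mxBorel S' ->
    Pr (Y @^-1` S `&` Z @^-1` S') = (Pr (Y @^-1` S) * Pr (Z @^-1` S'))%E.

Definition iid_copies d (T : measurableType d) (Pr : probability T R)
  dW (TW : measurableType dW) (PW : probability TW R) n
  (Wj : nat -> T -> 'cV[R]_n) (W : TW -> 'cV[R]_n) : Prop :=
  (forall j, random_vec Pr (Wj j) /\ same_law Pr PW (Wj j) W) /\
  forall (s : seq nat) (S : nat -> set 'cV[R]_n), uniq s ->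
    (forall j, mxBorel (S j)) ->
    Pr (\bigcap_(j in [set` s]) (Wj j @^-1` S j)) =
    (\prod_(j <- s) Pr (Wj j @^-1` S j))%E.

Definition mean d (T : measurableType d) (Pr : probability T R) n
  (X : T -> 'cV[R]_n) : 'cV[R]_n :=
  \col_i Rintegral Pr setT (fun w => X w i 0).

Definition sqnorm d (T : measurableType d) (Pr : probability T R) n
  (M : 'M[R]_n) (X : T -> 'cV[R]_n) : \bar R :=
  (\int[Pr]_w (qform M (X w))%:E)%E.

Definition stat_feasible nx nu nw (A : 'M[R]_nx) (B : 'M[R]_(nx, nu))
  (E : 'M[R]_(nx, nw)) dW (TW : measurableType dW) (PW : probability TW R)
  (W : TW -> 'cV[R]_nw) d (T : measurableType d) (Pr : probability T R)
  (X : T -> 'cV[R]_nx) (U : T -> 'cV[R]_nu) : Prop :=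
  L2vec Pr X /\ L2vec Pr U /\
  exists W' : T -> 'cV[R]_nw,
    random_vec Pr W' /\ same_law Pr PW W' W /\
    indep_vec Pr (fun w => col_mx (X w) (U w)) W' /\
    same_law Pr Pr X (fun w => A *m X w + B *m U w + E *m W' w).

Definition stat_cost nx nu (Q : 'M[R]_nx) (Rm : 'M[R]_nu)
  d (T : measurableType d) (Pr : probability T R)
  (X : T -> 'cV[R]_nx) (U : T -> 'cV[R]_nu) : \bar R :=
  (sqnorm Pr Q X + sqnorm Pr Rm U)%E.

End LQDefs.

(* Main.v *)
(* Writing S = R + B^T P B, the Riccati equation and the stationarity of the law
   of X turn the cost of a feasible pair into
     cstar + E[(U - K X - F E[W])^T S (U - K X - F E[W])],
   so cstar is a lower bound, and it is reached exactly when
   U = K X + F E[W] almost surely.  The dynamics then become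
   X ~ At X + B F E[W] + E W' with W' independent of X and At Schur stable.
   Iterating N times, E f(X) = E f(At^N X + sum_{j<N} At^j (B F E[W] + E W_j))
   for an independent i.i.d. sequence, and letting N tend to infinity identifies
   the law of X with that of X_oo.  Conversely the series for X_oo, built on the
   infinite product of the law of W, is stationary because prepending one
   coordinate to an i.i.d. sequence preserves its law. *)

Require Import Defs.
From HB Require Import structures.
From mathcomp Require Import all_boot all_order all_algebra all_classical all_reals all_analysis.
From mathcomp Require Import complex ring lra measurable_realfun.
Import Order.TTheory GRing.Theory Num.Theory numFieldNormedType.Exports.
Set Implicit Arguments. Unset Strict Implicit. Unset Printing Implicit Defensive.
Local Open Scope classical_set_scope.
Local Open Scope ring_scope.

(** * Powers of a Schur stable matrix *)

(** The space carrying [X] and [W'] is arbitrary and may be too poor for an i.i.d. sequence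
    independent of [X]. Independence from such a sequence is therefore expressed by iterated
    integrals over two spaces, and the input that enters at each iteration is exchanged, by equality
    in law, for the next term of the given [Wj]. The series for the limit converges almost surely,
    so laws are compared through bounded functions continuous along entrywise convergent sequences;
    products of exponentials attached to half-spaces suffice.

    For existence, the law of [W] lives on a space without topology, which rules out the compactness
    argument of Kolmogorov's theorem. Countable subadditivity on cylinders is proved instead by
    choosing coordinates one after the other, in the manner of Ionescu-Tulcea.

    In the cost, [G] is the sum of the [(At^T)^k P E] over [k >= 1]: it collects the effect of the
    mean of the future disturbances, and [F] is the feedforward that answers it. *)

Section GeometricDecay.
Variables (F : numClosedFieldType) (n : nat).
Implicit Types M X : 'M[F]_n.+1.

(** The right factor [X] allows the linear factors of the characteristic polynomial to be cancelled
    one at a time. *)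
Definition geom_decay M X := exists C rho : F,
  [/\ 0 <= C, 0 < rho, rho < 1 &
      forall N i j, `|(M ^+ N * X) i j| <= C * rho ^+ N].

(** Since [M^(N+1) X = z M^N X + M^N (M - z) X], the entries of [M^N X] obey a scalar recursion of
    ratio [z] with geometrically decaying input. *)
Lemma geom_decay_factor M X z : `|z| < 1 ->
  geom_decay M ((M - z%:M) * X) -> geom_decay M X.
Proof.
move=> z1 [C [rho [C0 r0 r1 H]]].
(* Here [1 - s = (1 - rho) (1 - |z|)], so [s] is below 1, at least [rho] and strictly above [|z|].
   The gap [e = s - |z|] absorbs the input through [|z| D + C <= s D], and is positive even when
   [|z| = rho]. *)
pose s := `|z| + rho * (1 - `|z|).
have zr : 0 < 1 - `|z| by rewrite subr_gt0.
have s0 : 0 < s by rewrite ltr_wpDl// mulr_gt0.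
have s1 : s < 1.
  rewrite -subr_gt0 (_ : 1 - s = (1 - rho) * (1 - `|z|)); last by rewrite /s; ring.
  by rewrite mulr_gt0// subr_gt0.
have rs : rho <= s.
  rewrite -subr_ge0 (_ : s - rho = (1 - rho) * `|z|); last by rewrite /s; ring.
  by rewrite mulr_ge0// subr_ge0 ltW.
pose e := rho * (1 - `|z|).
have e0 : 0 < e by rewrite mulr_gt0.
pose B := \sum_i \sum_j `|X i j|.
have XB i j : `|X i j| <= B.
  rewrite /B (bigD1 i)//= (bigD1 j)//= -addrA lerDl addr_ge0 ?sumr_ge0//.
  by move=> k _; rewrite sumr_ge0.
have B0 : 0 <= B by rewrite sumr_ge0// => i _; rewrite sumr_ge0.
pose D := B + C / e.
have D0 : 0 <= D by rewrite addr_ge0// divr_ge0// ltW.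
exists D, s; split => //; elim=> [|N IH] i j.
  by rewrite expr0 mul1r mulr1 (le_trans (XB i j))// lerDl divr_ge0// ltW.
have -> : M ^+ N.+1 * X = z *: (M ^+ N * X) + M ^+ N * ((M - z%:M) * X).
  rewrite mulrBl mulrBr addrC exprSr -mulrA.
  by rewrite -[z%:M * X]/(z%:M *m X) mul_scalar_mx scalerAr subrK.
rewrite mxE [X in X + _]mxE (le_trans (ler_normD _ _))// normrM.
apply: (@le_trans _ _ (`|z| * (D * s ^+ N) + C * s ^+ N)).
  apply: lerD; first by rewrite ler_wpM2l//; exact: IH.
  rewrite (le_trans (H N i j))// ler_wpM2l//.
  by rewrite lerXn2r// ?nnegrE ltW.
rewrite exprS mulrA -mulrDl [leRHS]mulrA.
apply: ler_wpM2r; first by rewrite exprn_ge0// ltW.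
rewrite -subr_ge0 (_ : _ - _ = e * B); last first.
  by rewrite /D /s -/e; field; exact: lt0r_neq0.
by rewrite mulr_ge0// ltW.
Qed.

Lemma geom_decay_prod M X (s : seq F) : (forall z, z \in s -> `|z| < 1) ->
  geom_decay M ((\prod_(z <- s) (M - z%:M)) * X) -> geom_decay M X.
Proof.
elim: s => [|z s IH] zs; first by rewrite big_nil mul1r.
rewrite big_cons -mulrA => /geom_decay_factor H; apply: IH => [x xs|].
  by apply: zs; rewrite inE xs orbT.
by apply: H; apply: zs; rewrite mem_head.
Qed.

(** By Cayley-Hamilton the product of all the factors [M - z] vanishes, and the zero matrix decays
    at any rate; cancelling the factors leads back to [1] without a Jordan form. *)
Lemma eigenvalue_decay M : (forall z, eigenvalue M z -> `|z| < 1) ->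
  geom_decay M 1.
Proof.
move=> Mz; have [s sE] := closed_field_poly_normal (char_poly M).
rewrite (monicP (char_poly_monic M)) scale1r in sE.
apply: (@geom_decay_prod M 1 s) => [z zs|].
  by apply: Mz; rewrite eigenvalue_root_char sE root_prod_XsubC.
have := Cayley_Hamilton M; rewrite sE rmorph_prod /=.
under eq_bigr do rewrite rmorphB/= horner_mx_X horner_mx_C.
move=> ->; exists 0, (2^-1); split => //; first by rewrite invf_lt1 ?ltr1n.
by move=> N i j; rewrite mul0r mulr0 !mxE normr0 mul0r.
Qed.

End GeometricDecay.

Section SchurStable.
Variables (R : realType) (n : nat) (M : 'M[R]_n).
Hypothesis sM : schur_stable M.

Lemma schur_stable_decay : exists C rho : R,
  [/\ 0 <= C, 0 < rho, rho < 1 &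
      forall N i j, `|(M ^+ N) i j| <= C * rho ^+ N].
Proof.
case: n M sM => [|m] A sA.
  exists 0, (2^-1); split => //; first by rewrite invf_lt1 ?ltr1n.
  by move=> N [].
pose Mc := map_mx (real_complex R) A.
(* [eigenvalue] is about row vectors and [schur_stable] about column vectors, hence the transpose.
   The constants obtained are complex but nonnegative, so they equal their real parts. *)
have [z /eigenvalueP[v vM v0]|C [rho [C0 r0 r1 H]]] := @eigenvalue_decay _ _ Mc^T.
  apply: (@sA z v^T); first by rewrite trmx_eq0.
  by rewrite -[LHS]trmxK trmx_mul trmxK vM linearZ.
have CE : ((complex.Re C)%:C)%C = C by rewrite RRe_real// ger0_real.
have rE : ((complex.Re rho)%:C)%C = rho by rewrite RRe_real// gtr0_real.
exists (complex.Re C), (complex.Re rho); split.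
- by rewrite -lecR CE.
- by rewrite -ltcR rE.
- by rewrite -ltcR rE.
move=> N i j; rewrite -lecR rmorphM rmorphXn/= CE rE.
apply: le_trans (H N j i).
rewrite mulr1 (_ : (Mc^T ^+ N) j i = ((A ^+ N) i j)%:C%C).
  by rewrite normc_def /= expr0n /= addr0 sqrtr_sqr.
have -> : Mc^T ^+ N = (Mc ^+ N)^T.
  elim: N => [|N IH]; rewrite ?trmx1// exprS IH [in RHS]exprSr.
    by rewrite -[(_ * Mc)^T]/((_ *m Mc)^T) trmx_mul.
by rewrite mxE -rmorphXn /= mxE.
Qed.

Lemma schur_stable_unit : 1%:M - M \in unitmx.
Proof.
rewrite -unitmx_tr -row_free_unit -kermx_eq0; apply/negP => /negP/rowV0Pn[v].
move=> /sub_kermxP vM v0.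
have : 1%:M *m v^T = M *m v^T.
  by apply/eqP; rewrite -subr_eq0 -mulmxBl -trmx_eq0 trmx_mul trmxK vM.
rewrite mul1mx => vE.
have := @sM 1 (map_mx (real_complex R) v^T); rewrite normr1 ltxx => H.
apply: notF; apply: H.
  by rewrite map_mx_eq0 trmx_eq0.
by rewrite scale1r -map_mxM -vE.
Qed.

Lemma geom_sum_mx N : \sum_(j < N) M ^+ j = (1%:M - M ^+ N) *m invmx (1%:M - M).
Proof.
have H : (\sum_(j < N) M ^+ j) *m (1%:M - M) = 1%:M - M ^+ N.
  elim: N => [|N IH]; first by rewrite big_ord0 mul0mx expr0 subrr.
  by rewrite big_ord_recr /= mulmxDl IH mulmxBr mulmx1 exprSr addrA subrK.
by rewrite -H mulmxK// schur_stable_unit.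
Qed.

Lemma cvg_geom_expr (C rho : R) : 0 < rho -> rho < 1 ->
  (fun N => C * rho ^+ N) @ \oo --> 0.
Proof.
move=> r0 r1; rewrite -[X in _ --> X](mulr0 C); apply: cvgMl_tmp.
by apply: cvg_expr; rewrite gtr0_norm.
Qed.

Lemma schur_stable_cvg0 p (X : 'M[R]_(n, p)) i k :
  (fun N => (M ^+ N *m X) i k) @ \oo --> (0 : R).
Proof.
have [C [rho [C0 r0 r1 H]]] := schur_stable_decay.
pose D := \sum_j C * `|X j k|.
have bound N : `|(M ^+ N *m X) i k| <= D * rho ^+ N.
  rewrite mxE (le_trans (ler_norm_sum _ _ _))// /D mulr_suml ler_sum// => j _.
  by rewrite normrM mulrAC ler_wpM2r.
apply: (@squeeze_cvgr _ _ _ _ (fun N => - (D * rho ^+ N)) (fun N => D * rho ^+ N)).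
- by apply: nearW => N; rewrite -ler_norml.
- by rewrite -[X in _ --> X]oppr0; apply: cvgN; exact: cvg_geom_expr.
- exact: cvg_geom_expr.
Qed.

Lemma schur_stable_series_cvg p (X : 'M[R]_(n, p)) i k :
  (fun N => ((\sum_(j < N) M ^+ j) *m X) i k) @ \oo -->
    (invmx (1%:M - M) *m X) i k.
Proof.
pose Y := invmx (1%:M - M) *m X.
have -> : (fun N => ((\sum_(j < N) M ^+ j) *m X) i k) =
    (fun N => Y i k - (M ^+ N *m Y) i k).
  apply/funext => N; rewrite geom_sum_mx -mulmxA mulmxBl mul1mx mxE.
  by rewrite [X in _ + X]mxE.
rewrite -[X in _ --> X]subr0; apply: (cvgB _ (schur_stable_cvg0 Y i k)).
exact: (cvg_cst (Y i k)).
Qed.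

End SchurStable.

(** * Infinite products of a probability *)

Section ProductProbability.
Context d1 d2 (T1 : measurableType d1) (T2 : measurableType d2) (R : realType).
Variables (P1 : probability T1 R) (P2 : probability T2 R).

Let prodT : (P1 \x P2)%E [set: T1 * T2] = 1%E.
Proof.
rewrite -setXTT product_measure1E// [X in (X * _)%E]probability_setT mul1e.
exact: probability_setT.
Qed.

HB.instance Definition _ := Measure_isProbability.Build _ _ _ (P1 \x P2)%E prodT.

Definition product_probability : probability (T1 * T2)%type R := (P1 \x P2)%E.

End ProductProbability.

Section ImageProbability.
Context d1 d2 (T1 : measurableType d1) (T2 : measurableType d2) (R : realType).
Variables (P : probability T1 R) (f : T1 -> T2) (mf : measurable_fun setT f).

Definition image_probability : probability T2 R :=
  distribution P (mfun_Sub (mem_set mf)).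

Lemma image_probabilityE A : image_probability A = P (f @^-1` A).
Proof. by []. Qed.

Lemma ge0_integral_image_probability (h : T2 -> \bar R) :
  measurable_fun setT h -> (forall y, (0 <= h y)%E) ->
  (\int[image_probability]_y h y = \int[P]_x h (f x))%E.
Proof. by move=> mh h0; rewrite ge0_integral_distribution. Qed.

End ImageProbability.

(** * Sequences, sections and cylinder sets *)

Section SequenceSpace.
Context d (T : measurableType d).

Definition seq_gen : set (set (nat -> T)) :=
  [set S | exists j (A : set T), measurable A /\ S = (fun w => w j) @^-1` A].

Definition seq_space := g_sigma_algebraType seq_gen.

Definition scons (p : T * (nat -> T)) : nat -> T :=
  fun j => if j is j'.+1 then p.2 j' else p.1.

Lemma measurable_coord j : measurable_fun setT (fun w : seq_space => w j).
Proof.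
move=> _ A mA; rewrite setTI; apply: sub_sigma_algebra.
by exists j, A.
Qed.

Lemma measurable_scons :
  measurable_fun setT (scons : T * seq_space -> seq_space).
Proof.
apply: (@measurability _ _ _ seq_space _ _ seq_gen) => // _ [_ [j [A [mA ->]] <-]].
rewrite setTI; case: j => [|j] /=.
  rewrite (_ : _ @^-1` _ = (fst : T * seq_space -> T) @^-1` A)//.
  by rewrite -[X in measurable X]setTI; exact: measurable_fst.
rewrite (_ : _ @^-1` _ = ((fun w : seq_space => w j) \o snd) @^-1` A)//.
rewrite -[X in measurable X]setTI.
by apply: (measurableT_comp (measurable_coord j) measurable_snd).
Qed.

Definition section0 (w0 : T) (A : set (nat -> T)) : set (nat -> T) :=
  [set w | A (scons (w0, w))].

Lemma section0E w0 A : section0 w0 A = xsection (scons @^-1` A) w0.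
Proof. by apply/seteqP; split => w; rewrite /xsection /= inE. Qed.

Lemma measurable_section0 (w0 : T) (A : set seq_space) :
  measurable A -> measurable (section0 w0 A : set seq_space).
Proof.
move=> mA; rewrite section0E; apply: measurable_xsection.
by rewrite -[X in measurable X]setTI; exact: measurable_scons.
Qed.

Definition depends_on n (A : set (nat -> T)) :=
  forall w w', (forall j, (j < n)%N -> w j = w' j) -> A w -> A w'.

Lemma depends_on_section0 n w0 A :
  depends_on n.+1 A -> depends_on n (section0 w0 A).
Proof.
move=> dA w w' ww'; apply: dA => -[//|j] /=; rewrite ltnS; exact: ww'.
Qed.

Lemma depends_onW n m A : (n <= m)%N -> depends_on n A -> depends_on m A.
Proof.
move=> nm dA w w' ww'; apply: dA => j jn; apply: ww'; exact: leq_trans nm.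
Qed.

Lemma depends_on0 A : depends_on 0 A -> A = set0 \/ A = setT.
Proof.
move=> dA; have [->|/set0P[w Aw]] := eqVneq A set0; [by left|right].
by apply/seteqP; split => // w' _; exact: dA Aw.
Qed.

Lemma depends_onU n A B :
  depends_on n A -> depends_on n B -> depends_on n (A `|` B).
Proof. by move=> dA dB w w' ww' [/(dA _ _ ww')|/(dB _ _ ww')]; [left|right]. Qed.

Lemma depends_onC n A : depends_on n A -> depends_on n (~` A).
Proof.
by move=> dA w w' ww' nAw Aw'; apply/nAw/(dA w') => // j /ww'.
Qed.

(** Any measurable dependence on finitely many coordinates is allowed, so that cylinders form an
    algebra of sets; rectangles are not closed under complement. *)
Definition cylinder (A : set (nat -> T)) :=
  (measurable (A : set seq_space)) /\ exists n, depends_on n A.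

Lemma cylinder0 : cylinder set0.
Proof. by split; [exact: measurable0 | exists 0%N => ? ?]. Qed.

Lemma cylinderC A : cylinder A -> cylinder (~` A).
Proof.
move=> [mA [n dA]]; split; first exact: measurableC.
by exists n; exact: depends_onC.
Qed.

Lemma cylinderU A B : cylinder A -> cylinder B -> cylinder (A `|` B).
Proof.
move=> [mA [n dA]] [mB [m dB]]; split; first exact: measurableU.
exists (maxn n m); apply: depends_onU.
  exact: depends_onW (leq_maxl _ _) dA.
exact: depends_onW (leq_maxr _ _) dB.
Qed.

Lemma cylinder_coord j (A : set T) : measurable A ->
  cylinder ((fun w => w j) @^-1` A).
Proof.
move=> mA; split.
  by rewrite -[X in measurable X]setTI; exact: measurable_coord.
by exists j.+1 => w w' ww' /=; rewrite ww'.
Qed.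

Lemma cylinder_section0 w0 A : cylinder A -> cylinder (section0 w0 A).
Proof.
move=> [mA [n dA]]; split; first exact: measurable_section0.
by exists n; apply: depends_on_section0; exact: depends_onW (leqnSn n) dA.
Qed.

(** A second copy of the sequence type, carrying the algebra of cylinders from which the measure is
    extended, whereas [seq_space] carries the generated sigma-algebra. *)
Definition cyl_space := (nat -> T).
HB.instance Definition _ := Pointed.on cyl_space.
HB.instance Definition _ := isAlgebraOfSets.Build default_measure_display
  cyl_space cylinder0 cylinderU cylinderC.

End SequenceSpace.

(** * The product content on cylinders *)

Section InfiniteProduct.
Context d (T : measurableType d) (R : realType) (P : probability T R).
Local Open Scope ereal_scope.

(** Law of [n] independent draws followed by a fixed tail; a set that depends on the first [n]
    coordinates does not see the tail. *)
Fixpoint trunc_prob n : probability (seq_space T) R :=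
  if n is n'.+1 then
    image_probability (product_probability P (trunc_prob n'))
      (@measurable_scons _ T)
  else \d_ (point : seq_space T).

Lemma trunc_probS n (A : set (seq_space T)) :
  trunc_prob n.+1 A = \int[P]_w0 trunc_prob n (section0 w0 A).
Proof.
rewrite [LHS](_ : _ = \int[P]_w0 trunc_prob n (xsection (@scons _ T @^-1` A) w0))//.
by apply: eq_integral => w0 _; rewrite section0E.
Qed.

Lemma trunc_prob_stable n m A : measurable (A : set (seq_space T)) ->
  depends_on n A -> (n <= m)%N -> trunc_prob m A = trunc_prob n A.
Proof.
elim: n m A => [|n IH] m A mA dA.
  by case: (depends_on0 dA) => ->; rewrite ?measure0// !probability_setT.
case: m => // m; rewrite ltnS => nm; rewrite !trunc_probS.
apply: eq_integral => w0 _; apply: IH => //; first exact: measurable_section0.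
exact: depends_on_section0.
Qed.

(** On a cylinder the sequence is eventually constant, so the limit yields the common value without
    choosing a level. *)
Definition cyl_content (A : set (cyl_space T)) : \bar R :=
  limn (fun n => trunc_prob n A).

Lemma cyl_contentE n A : measurable (A : set (seq_space T)) ->
  depends_on n A -> cyl_content A = trunc_prob n A.
Proof.
move=> mA dA; apply: lim_near_cst => //.
exists n => // m /= nm; exact: trunc_prob_stable.
Qed.

Lemma cyl_content_eventually A : measurable (A : set (cyl_space T)) ->
  exists2 n, depends_on n A &
   forall m, (n <= m)%N -> cyl_content A = trunc_prob m A.
Proof.
move=> [mA [n dA]]; exists n => // m nm.
by apply: cyl_contentE => //; exact: depends_onW dA.
Qed.

Lemma cyl_content0 : cyl_content set0 = 0.
Proof.
by have [n _ /(_ n (leqnn n)) ->] := cyl_content_eventually (cylinder0 T); rewrite measure0.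
Qed.

Lemma cyl_contentT : cyl_content setT = 1.
Proof.
rewrite (@cyl_contentE 0%N) => //; first exact: probability_setT.
Qed.

Lemma cyl_content_ge0 A : 0 <= cyl_content A.
Proof.
have [c|nc] := pselect (cvgn (fun n => trunc_prob n A)).
  by apply: lime_ge => //; apply: nearW.
(* A divergent limit is the default value of [\bar R], which is still nonnegative. *)
by rewrite /cyl_content (dvgP nc).
Qed.

(** Fubini along the first coordinate, the source of both countable subadditivity and invariance
    under prepending. *)
Lemma cyl_content_section A : measurable (A : set (cyl_space T)) ->
  cyl_content A = \int[P]_w0 cyl_content (section0 w0 A).
Proof.
move=> [mA [n dA]]; have dA' : depends_on n.+1 A by exact: depends_onW dA.
rewrite (cyl_contentE mA dA') trunc_probS; apply: eq_integral => w0 _.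
rewrite (@cyl_contentE n)//; first exact: measurable_section0.
exact: depends_on_section0.
Qed.

Lemma measurable_cyl_content_section A : measurable (A : set (cyl_space T)) ->
  measurable_fun [set: T] (fun w0 => cyl_content (section0 w0 A) : \bar R).
Proof.
move=> [mA [n dA]].
rewrite (_ : (fun _ => _) = trunc_prob n \o xsection (@scons _ T @^-1` A)).
  apply: measurable_fun_xsection.
  rewrite -[X in measurable X]setTI; exact: measurable_scons.
apply/funext => w0 /=; rewrite -section0E; apply: cyl_contentE.
  exact: measurable_section0.
by apply: depends_on_section0; exact: depends_onW dA.
Qed.

(** Finitely many cylinders share a level, at which the content coincides with the measure
    [trunc_prob]. *)
Lemma cyl_content_semi_additive : measure_function.semi_additive cyl_content.
Proof.
move=> F n mF tF mU.
have [N hN] : exists N, forall i : 'I_n, depends_on N (F i).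
  elim: n {mU} => [|n [N IH]]; first by exists 0%N => -[].
  have [_ [m dm]] := mF n; exists (maxn N m) => i.
  have := ltn_ord i; rewrite ltnS leq_eqVlt => /orP[/eqP ->|ilt].
    exact: depends_onW (leq_maxr _ _) dm.
  exact: depends_onW (leq_maxl _ _) (IH (Ordinal ilt)).
have [mU' _] := mU; have [M dM hM] := cyl_content_eventually mU.
rewrite (hM (maxn M N))//; last exact: leq_maxl.
rewrite measure_semi_additive_ord_I; last 3 first.
- by move=> i _; have [] := mF i.
- exact: sub_trivIset tF.
- exact: mU'.
apply: eq_bigr => i _; apply/esym/cyl_contentE; first by have [] := mF i.
exact: depends_onW (leq_maxr _ _) (hN i).
Qed.

(* A strict failure of subadditivity survives in the section at a well-chosen
   first coordinate, hence, coordinate after coordinate, along a whole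
   sequence [w]; but the sections of cylinders along [w] become trivial. *)
Lemma cyl_content_sigma_subadditive :
  measurable_subset_sigma_subadditive cyl_content.
Proof.
move=> A F mF mA AF; rewrite leNgt; apply/negP => lt0.
pose good (p : set (cyl_space T) * (nat -> set (cyl_space T))) :=
  [/\ measurable p.1, forall k, measurable (p.2 k) &
      \sum_(0 <= k <oo) cyl_content (p.2 k) < cyl_content p.1].
pose sec w0 (p : set (cyl_space T) * (nat -> set (cyl_space T))) :=
  (section0 w0 p.1 : set (cyl_space T),
   fun k => section0 w0 (p.2 k) : set (cyl_space T)).
(* If subadditivity held in every section, integrating it over the first coordinate would give it
   for [p]. *)
have step p : good p -> exists w0, good (sec w0 p).
  move=> [m1 m2 lt]; apply: contrapT => /forallNP H.
  move: lt; apply/negP; rewrite -leNgt (cyl_content_section m1).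
  under eq_eseriesr do rewrite cyl_content_section//.
  rewrite -integral_nneseries//; last 2 first.
  - by move=> n; exact: measurable_cyl_content_section.
  - by move=> n x _; exact: cyl_content_ge0.
  apply: ge0_le_integral => //.
  - by move=> x _; exact: cyl_content_ge0.
  - exact: measurable_cyl_content_section.
  - apply: ge0_emeasurable_sum => n; first by move=> x _ _; exact: cyl_content_ge0.
    by move=> _; exact: measurable_cyl_content_section.
  move=> w0 _; rewrite leNgt; apply/negP => lt; apply: (H w0).
  by split => [|k|//]; [exact: (cylinder_section0 w0 m1) |
                        exact: (cylinder_section0 w0 (m2 k))].
pose next p := xget point [set w0 | good (sec w0 p)].
have nextP p : good p -> good (sec (next p) p).
  move=> gp; have [w0 gw0] := step p gp.
  by rewrite /next; case: xgetP => [_ _ //|/(_ w0)].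
pose st n := iter n (fun p => sec (next p) p) (A, F).
have gst n : good (st n) by elim: n => [|n IH]; [split | exact: nextP].
pose w j := next (st j).
(* The [m]-fold section along [w] consists of the [v] whose extension by the first [m] terms of [w]
   lies in the original set. *)
pose app m (v : nat -> T) := fun j => if (j < m)%N then w j else v (j - m)%N.
have appS m v : app m.+1 v = app m (scons (w m, v)).
  apply/funext => j; rewrite /app ltnS leq_eqVlt.
  have [->|jm] := eqVneq j m; first by rewrite ltnn subnn.
  rewrite /=; case: ltnP => //= mj.
  have {}mj : (m < j)%N by rewrite ltn_neqAle eq_sym jm.
  by rewrite /scons -(subnSK mj).
have st1 m v : (st m).1 v <-> A (app m v).
  elim: m v => [|m IH] v.
    by rewrite /= (_ : app 0%N v = v)//; apply/funext => j; rewrite /app subn0.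
  rewrite appS; exact: (IH (scons (w m, v))).
have st2 m k v : (st m).2 k v <-> F k (app m v).
  elim: m v => [|m IH] v.
    by rewrite /= (_ : app 0%N v = v)//; apply/funext => j; rewrite /app subn0.
  rewrite appS; exact: (IH (scons (w m, v))).
have agree m v j : (j < m)%N -> app m v j = w j by rewrite /app => ->.
(* The [n]-fold section of [A] has positive content, hence a point, and [A] only looks at the first
   [n] coordinates, which are those of [w]. *)
have Aw : A w.
  have [_ [n dA]] := mA.
  have [m1 m2 lt] := gst n.
  have [E|/set0P[v Av]] := eqVneq (st n).1 set0.
    move: lt; rewrite E cyl_content0 ltNge => /negP[].
    by apply: nneseries_ge0 => k _ _; exact: cyl_content_ge0.
  move/st1: Av; apply: dA => j; exact: agree.
have [k _ Fkw] := AF _ Aw.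
have [_ [n dF]] := mF k.
have [m1 m2 lt] := gst n.
(* [w] lies in [F k], which depends on [n] coordinates, so its [n]-fold section is everything. The
   series is then at least 1, against a content at most 1. *)
have E : (st n).2 k = setT.
  apply/seteqP; split => // v _; apply/st2; apply: dF Fkw => j jn.
  by rewrite agree.
have le1 : 1 <= \sum_(0 <= k <oo) cyl_content ((st n).2 k).
  rewrite -cyl_contentT -E; rewrite (nneseriesD1 (n := k))//.
    by rewrite leeDl// nneseries_ge0// => j _ _; exact: cyl_content_ge0.
  by move=> j _; exact: cyl_content_ge0.
move: lt; rewrite ltNge => /negP[]; apply: le_trans le1.
have [N _ /(_ N (leqnn N)) ->] := cyl_content_eventually m1.
by apply: probability_le1; case: m1.
Qed.

End InfiniteProduct.

(** * Extension to a probability on sequences *)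

Section InfiniteProductMeasure.
Context d (T : measurableType d) (R : realType) (P : probability T R).
Local Open Scope ereal_scope.

HB.instance Definition _ := isContent.Build _ _ _ (cyl_content P)
  (cyl_content_ge0 P) (cyl_content_semi_additive P).
HB.instance Definition _ := Content_SigmaSubAdditive_isMeasure.Build _ _ _
  (cyl_content P) (cyl_content_sigma_subadditive P).

Let Cyl := g_sigma_algebraType (@measurable _ (cyl_space T)).
Let mu : set Cyl -> \bar R := measure_extension (cyl_content P).

Let muE A : cylinder A -> mu A = cyl_content P A.
Proof. by move=> cA; rewrite [LHS]measurable_mu_extE. Qed.

Let mu_setT : mu setT = 1.
Proof.
rewrite muE ?cyl_contentT//; split; first exact: measurableT.
by exists 0%N.
Qed.

HB.instance Definition _ := Measure_isProbability.Build _ _ _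
  (measure_extension (cyl_content P)) mu_setT.

Let Mu : probability Cyl R := measure_extension (cyl_content P).

Let measurable_id : measurable_fun setT (idfun : Cyl -> seq_space T).
Proof.
apply: (@measurability _ _ Cyl (seq_space T) _ _ (@seq_gen _ T)) => //.
move=> _ [_ [j [A [mA ->]] <-]]; rewrite setTI; apply: sub_sigma_algebra.
exact: cylinder_coord.
Qed.

(** The image under the identity only transports the extension from the sigma-algebra generated by
    cylinders to that of [seq_space]. *)
Definition infprod : probability (seq_space T) R := image_probability Mu measurable_id.

Lemma infprodE A : cylinder A -> infprod A = cyl_content P A.
Proof. exact: muE. Qed.

(** Both sides are probabilities; on cylinders, a generating family closed under intersection, they
    agree by [cyl_content_section]. *)
Lemma infprod_scons (A : set (seq_space T)) : measurable A ->
  product_probability P infprod (@scons _ T @^-1` A) = infprod A.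
Proof.
move=> mA.
rewrite -[LHS](image_probabilityE _ (@measurable_scons _ T)).
apply: (@g_sigma_algebra_measure_unique _ R (seq_space T) (@cylinder _ T) _
  (fun=> setT) _ _ (image_probability (product_probability P infprod)
    (@measurable_scons _ T)) infprod).
- by move=> B [].
- by move=> _; split; [exact: measurableT | exists 0%N].
- by rewrite bigcup_const//; exists 0%N.
- move=> B C cB cC; rewrite -[B `&` C]setCK setCI; apply: cylinderC.
  by apply: cylinderU; exact: cylinderC.
- move=> B cB; transitivity (cyl_content P B); last exact/esym/infprodE.
  rewrite cyl_content_section//.
  rewrite [LHS](_ : _ = \int[P]_w0 infprod (xsection (@scons _ T @^-1` B) w0))//.
  apply: eq_integral => w0 _ /=; rewrite -section0E.
  by apply: infprodE; exact: cylinder_section0.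
- by move=> _; rewrite /= [X in X < _]probability_setT ltry.
- suff : <<s @seq_gen _ T >> `<=` <<s @cylinder _ T >> by exact.
  apply: sub_smallest2r => // _ [j [B [mB ->]]]; exact: cylinder_coord.
Qed.

End InfiniteProductMeasure.

(** * Random vectors *)

Section VectorSpace.
Variable R : realType.

Definition vec_gen n : set (set 'cV[R]_n) :=
  [set S | exists (i : 'I_n) (A : set R), measurable A /\
             S = (fun v : 'cV[R]_n => v i 0) @^-1` A].

(* ['cV[R]_n] with [mxBorel] as its canonical sigma-algebra. *)
Definition vec n := g_sigma_algebraType (@vec_gen n).

Lemma measurable_entry n (i : 'I_n) :
  measurable_fun setT (fun v : vec n => v i 0 : R).
Proof. by move=> _ A mA; rewrite setTI; apply: sub_sigma_algebra; exists i, A. Qed.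

Context d (T : measurableType d) (Pr : probability T R).

Lemma random_vecP n (X : T -> 'cV[R]_n) :
  random_vec Pr X <-> measurable_fun setT (X : T -> vec n).
Proof.
split=> [mX|mX i]; last exact: (measurableT_comp (measurable_entry i) mX).
apply: (@measurability _ _ T (vec n) _ _ (@vec_gen n)) => //.
move=> _ [_ [i [A [mA ->]] <-]]; rewrite setTI.
by rewrite -[X in measurable X]setTI; exact: (mX i measurableT A mA).
Qed.

Lemma random_vecD n (X Y : T -> 'cV[R]_n) :
  random_vec Pr X -> random_vec Pr Y -> random_vec Pr (fun w => X w + Y w).
Proof.
move=> mX mY i; under eq_fun do rewrite mxE.
by apply: measurable_funD; [exact: mX | exact: mY].
Qed.

Lemma random_vecM m n (A : 'M[R]_(m, n)) (X : T -> 'cV[R]_n) :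
  random_vec Pr X -> random_vec Pr (fun w => A *m X w).
Proof.
move=> mX i; under eq_fun do rewrite mxE.
apply: measurable_sum => j; apply: measurable_funM; last exact: mX.
exact: measurable_cst.
Qed.

Lemma random_vec_cst n (a : 'cV[R]_n) : random_vec Pr (fun=> a).
Proof. by move=> i; exact: measurable_cst. Qed.

Lemma random_vec_sum n I (s : seq I) (X : I -> T -> 'cV[R]_n) :
  (forall j, random_vec Pr (X j)) -> random_vec Pr (fun w => \sum_(j <- s) X j w).
Proof.
move=> mX; elim: s => [|i s IH].
  by under eq_fun do rewrite big_nil; exact: random_vec_cst.
by under eq_fun do rewrite big_cons; exact: random_vecD.
Qed.

Lemma random_vec_col n m (X : T -> 'cV[R]_n) (Y : T -> 'cV[R]_m) :
  random_vec Pr X -> random_vec Pr Y ->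
  random_vec Pr (fun w => col_mx (X w) (Y w)).
Proof.
move=> mX mY i; under eq_fun do rewrite mxE.
by case: (fintype.split i) => j; [exact: mX | exact: mY].
Qed.

End VectorSpace.

Arguments vec R n : clear implicits.

Lemma measurable_vecP (R : realType) d (T : measurableType d) n
    (g : T -> vec R n) :
  (forall i, measurable_fun setT (fun v => g v i 0)) -> measurable_fun setT g.
Proof. by move=> mg; exact/(random_vecP (\d_ (point : T))). Qed.

Lemma measurable_mulmx (R : realType) m n (A : 'M[R]_(m, n)) :
  measurable_fun setT (fun v : vec R n => A *m v : vec R m).
Proof.
apply: measurable_vecP => i; under eq_fun do rewrite mxE.
apply: measurable_sum => j; apply: measurable_funM; last exact: measurable_entry.
exact: measurable_cst.
Qed.

Section SameLaw.
Variable R : realType.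
Context d1 (T1 : measurableType d1) (Pr1 : probability T1 R)
        d2 (T2 : measurableType d2) (Pr2 : probability T2 R).
Local Open Scope ereal_scope.

Lemma ge0_same_law_integral n (X : T1 -> 'cV[R]_n) (Y : T2 -> 'cV[R]_n)
    (f : vec R n -> \bar R) :
  random_vec Pr1 X -> random_vec Pr2 Y -> same_law Pr1 Pr2 X Y ->
  measurable_fun setT f -> (forall v, 0 <= f v) ->
  \int[Pr1]_w f (X w) = \int[Pr2]_w f (Y w).
Proof.
move=> /random_vecP mX /random_vecP mY XY mf f0.
rewrite -[LHS](ge0_integral_image_probability Pr1 mX)//.
rewrite -[RHS](ge0_integral_image_probability Pr2 mY)//.
by apply: eq_measure_integral => A mA _; exact: XY.
Qed.

Lemma same_law_integral n (X : T1 -> 'cV[R]_n) (Y : T2 -> 'cV[R]_n)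
    (f : vec R n -> \bar R) :
  random_vec Pr1 X -> random_vec Pr2 Y -> same_law Pr1 Pr2 X Y ->
  measurable_fun setT f ->
  \int[Pr1]_w f (X w) = \int[Pr2]_w f (Y w).
Proof.
move=> mX mY XY mf; rewrite [LHS]integralE [RHS]integralE.
congr (_ - _).
  (* Unfolding and refolding turns the positive part of the composite into the positive part of [f]
     evaluated at [X w]. *)
  under eq_integral do rewrite funeposE -[maxe _ _]funeposE.
  under [RHS]eq_integral do rewrite funeposE -[maxe _ _]funeposE.
  have /(ge0_same_law_integral mX mY XY) H := measurable_funepos mf.
  by apply: H => v; exact: funepos_ge0.
under eq_integral do rewrite funenegE -[maxe _ _]funenegE.
under [RHS]eq_integral do rewrite funenegE -[maxe _ _]funenegE.
have /(ge0_same_law_integral mX mY XY) H := measurable_funeneg mf.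
by apply: H => v; exact: funeneg_ge0.
Qed.

Lemma same_law_integrable n (X : T1 -> 'cV[R]_n) (Y : T2 -> 'cV[R]_n)
    (f : vec R n -> \bar R) :
  random_vec Pr1 X -> random_vec Pr2 Y -> same_law Pr1 Pr2 X Y ->
  measurable_fun setT f ->
  Pr2.-integrable setT (f \o Y) -> Pr1.-integrable setT (f \o X).
Proof.
move=> mX mY XY mf /integrableP[_ fY]; apply/integrableP; split.
  exact: (measurableT_comp mf ((random_vecP Pr1 X).1 mX)).
have E : \int[Pr1]_x `|(f \o X) x| = \int[Pr2]_x `|(f \o Y) x|.
  apply: (ge0_same_law_integral (f := abse \o f) mX mY XY) => //.
  - by apply: (measurableT_comp _ mf); exact: abse_measurable.
  - by move=> v; exact: abse_ge0.
by rewrite E.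
Qed.

Lemma same_law_comp n m (X : T1 -> 'cV[R]_n) (Y : T2 -> 'cV[R]_n)
    (g : vec R n -> vec R m) :
  measurable_fun setT g -> same_law Pr1 Pr2 X Y ->
  same_law Pr1 Pr2 (fun w => g (X w)) (fun w => g (Y w)).
Proof.
move=> mg XY S mS; apply: (XY (g @^-1` S)).
have := mg measurableT S mS; rewrite setTI; exact.
Qed.

End SameLaw.

Section Independence.
Variable R : realType.
Context d (T : measurableType d) (Pr : probability T R).
Local Open Scope ereal_scope.
Variables (n m : nat) (Y : T -> 'cV[R]_n) (Z : T -> 'cV[R]_m).
Hypotheses (mY : random_vec Pr Y) (mZ : random_vec Pr Z).
Hypothesis YZ : indep_vec Pr Y Z.

Let mY' : measurable_fun setT (Y : T -> vec R n) := (random_vecP Pr Y).1 mY.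
Let mZ' : measurable_fun setT (Z : T -> vec R m) := (random_vecP Pr Z).1 mZ.
Let mYZ : measurable_fun setT (fun w => (Y w : vec R n, Z w : vec R m)) :=
  measurable_fun_pair mY' mZ'.

(** Independence fixes the joint law on rectangles, so it is the product of the marginals, and
    Tonelli applies. *)
Lemma indep_integral (f : vec R n * vec R m -> \bar R) :
  measurable_fun setT f -> (forall p, 0 <= f p) ->
  \int[Pr]_w f (Y w, Z w) = \int[Pr]_w \int[Pr]_w' f (Y w, Z w').
Proof.
move=> mf f0.
rewrite -[LHS](ge0_integral_image_probability Pr mYZ)//.
pose mu1 := image_probability Pr mY'; pose mu2 := image_probability Pr mZ'.
transitivity (\int[mu1 \x mu2]_p f p).
  apply: eq_measure_integral => A mA _; apply/esym.
  by apply: product_measure_unique => // B C mB mC; exact: YZ.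
rewrite fubini_tonelli1//.
rewrite (ge0_integral_image_probability Pr mY')//; last first.
- by move=> y; exact: integral_ge0.
- exact: measurable_fun_fubini_tonelli_F.
apply: eq_integral => w _ /=.
apply: (ge0_integral_image_probability Pr mZ' (h := fun z => f (Y w, z))) => //.
exact: (measurableT_comp mf (pair1_measurable _)).
Qed.

End Independence.

(** * Expectations and second moments *)

Section Expectation.
Context d (T : measurableType d) (R : realType) (Pr : probability T R).
Implicit Types f g : T -> R.

Definition L1 f := Pr.-integrable setT (EFin \o f).
Definition Ex f : R := Rintegral Pr setT f.

Lemma L1_measurable f : L1 f -> measurable_fun setT f.
Proof. by move=> /integrableP[/measurable_EFinP]. Qed.

Lemma L1_EFin f : L1 f -> (\int[Pr]_w (f w)%:E = (Ex f)%:E)%E.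
Proof. by move=> If; rewrite /Ex /Rintegral fineK//; exact: integrable_fin_num. Qed.

Lemma L1_cst c : L1 (fun=> c).
Proof. exact: finite_measure_integrable_cst. Qed.

Lemma L1D f g : L1 f -> L1 g -> L1 (fun w => f w + g w).
Proof. by move=> If Ig; exact: (integrableD measurableT If Ig). Qed.

Lemma L1Z c f : L1 f -> L1 (fun w => c * f w).
Proof. by move=> If; exact: (integrableZl measurableT c If). Qed.

Lemma L1_sum I (s : seq I) (f : I -> T -> R) :
  (forall i, L1 (f i)) -> L1 (fun w => \sum_(i <- s) f i w).
Proof.
move=> If; rewrite /L1 (_ : _ \o _ = fun w => (\sum_(i <- s) (f i w)%:E)%E).
  by apply: integrable_sum => // i _; exact: If.
by apply/funext => w /=; rewrite sumEFin.
Qed.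

Lemma L1_le f g : measurable_fun setT f -> (forall w, `|f w| <= g w) ->
  L1 g -> L1 f.
Proof.
move=> mf fg Ig; apply: (le_integrable measurableT _ _ Ig).
  exact/measurable_EFinP.
by move=> w _ /=; rewrite lee_fin (le_trans (fg w))// ler_norm.
Qed.

Lemma ExD f g : L1 f -> L1 g -> Ex (fun w => f w + g w) = Ex f + Ex g.
Proof. by move=> If Ig; exact: RintegralD. Qed.

Lemma ExZ c f : L1 f -> Ex (fun w => c * f w) = c * Ex f.
Proof. by move=> If; exact: RintegralZl. Qed.

Lemma Ex_cst c : Ex (fun=> c) = c.
Proof. by rewrite /Ex Rintegral_cst// [X in fine X]probability_setT mulr1. Qed.

Lemma Ex_sum I (s : seq I) (f : I -> T -> R) : (forall i, L1 (f i)) ->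
  Ex (fun w => \sum_(i <- s) f i w) = \sum_(i <- s) Ex (f i).
Proof.
move=> If; elim: s => [|i s IH].
  by rewrite big_nil; under [X in Ex X]eq_fun do rewrite big_nil; exact: Ex_cst.
rewrite big_cons -IH -ExD//; last exact: L1_sum.
by congr Ex; apply/funext => w; rewrite big_cons.
Qed.

Lemma Ex_ge0 f : (forall w, 0 <= f w) -> 0 <= Ex f.
Proof. by move=> f0; exact: Rintegral_ge0. Qed.

Lemma Ex_eq0 f : L1 f -> (forall w, 0 <= f w) -> Ex f = 0 ->
  {ae Pr, forall w, f w = 0}.
Proof.
move=> If f0 Ef.
have : (\int[Pr]_w `|(f w)%:E| = 0)%E.
  under eq_integral do rewrite gee0_abs ?lee_fin//.
  by rewrite L1_EFin// Ef.
have mf : measurable_fun setT (EFin \o f) by case/integrableP : If.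
move=> /(ae_eq_integral_abs Pr measurableT mf).
by apply: filterS => w /(_ I) [].
Qed.

End Expectation.

Section SecondMoments.
Context d (T : measurableType d) (R : realType) (Pr : probability T R).

Lemma L2_L1 n (X : T -> 'cV[R]_n) i : L2vec Pr X -> L1 Pr (fun w => X w i 0).
Proof.
move=> [mX IX]; apply: (@L1_le _ _ _ _ _ (fun w => 1 + X w i 0 ^+ 2)) => //.
  move=> w; have := sqr_ge0 (`|X w i 0| - 1); rewrite -(real_normK (num_real (X w i 0))).
  have := normr_ge0 (X w i 0); nra.
by apply: L1D; [exact: L1_cst | exact: IX].
Qed.

Lemma L2_L1M n m (X : T -> 'cV[R]_n) (Y : T -> 'cV[R]_m) i j :
  L2vec Pr X -> L2vec Pr Y -> L1 Pr (fun w => X w i 0 * Y w j 0).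
Proof.
move=> [mX IX] [mY IY].
apply: (@L1_le _ _ _ _ _ (fun w => X w i 0 ^+ 2 + Y w j 0 ^+ 2)) => //.
- exact: measurable_funM.
- move=> w; rewrite normrM -(real_normK (num_real (X w i 0))).
  rewrite -(real_normK (num_real (Y w j 0))).
  have := sqr_ge0 (`|X w i 0| - `|Y w j 0|).
  have := normr_ge0 (X w i 0); have := normr_ge0 (Y w j 0); nra.
- by apply: L1D; [exact: IX | exact: IY].
Qed.

Lemma L2vec_cst n (a : 'cV[R]_n) : L2vec Pr (fun=> a).
Proof. by split=> i; [exact: measurable_cst | exact: L1_cst]. Qed.

Lemma L2vecD n (X Y : T -> 'cV[R]_n) :
  L2vec Pr X -> L2vec Pr Y -> L2vec Pr (fun w => X w + Y w).
Proof.
move=> LX LY; split=> [|i]; first exact: (random_vecD LX.1 LY.1).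
rewrite (_ : (fun w => _) = EFin \o (fun w => X w i 0 * X w i 0
  + (2 * (X w i 0 * Y w i 0) + Y w i 0 * Y w i 0))).
  apply: L1D; first exact: L2_L1M.
  by apply: L1D; [apply: L1Z|]; exact: L2_L1M.
by apply/funext => w /=; rewrite mxE; congr EFin; ring.
Qed.

Lemma L2vecM m n (A : 'M[R]_(m, n)) (X : T -> 'cV[R]_n) :
  L2vec Pr X -> L2vec Pr (fun w => A *m X w).
Proof.
move=> LX; split=> [|i]; first exact: (random_vecM A LX.1).
rewrite (_ : (fun w => _) = EFin \o (fun w => \sum_j \sum_k
    (A i j * A i k) * (X w j 0 * X w k 0))).
  apply: L1_sum => j; apply: L1_sum => k; apply: L1Z; exact: L2_L1M.
apply/funext => w /=; rewrite mxE expr2 mulr_suml; congr EFin.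
apply: eq_bigr => j _; rewrite mulr_sumr; apply: eq_bigr => k _; ring.
Qed.

Lemma meanD n (X Y : T -> 'cV[R]_n) : L2vec Pr X -> L2vec Pr Y ->
  mean Pr (fun w => X w + Y w) = mean Pr X + mean Pr Y.
Proof.
move=> LX LY; apply/colP => i; rewrite !mxE.
rewrite -[RHS](ExD (L2_L1 i LX) (L2_L1 i LY)); congr (Ex Pr _).
by apply/funext => w; rewrite mxE.
Qed.

Lemma meanM m n (A : 'M[R]_(m, n)) (X : T -> 'cV[R]_n) : L2vec Pr X ->
  mean Pr (fun w => A *m X w) = A *m mean Pr X.
Proof.
move=> LX; apply/colP => i; rewrite !mxE.
transitivity (Ex Pr (fun w => \sum_j A i j * X w j 0)).
  by congr (Ex Pr _); apply/funext => w; rewrite mxE.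
rewrite Ex_sum => [|j]; last exact/L1Z/L2_L1.
by apply: eq_bigr => j _; rewrite ExZ ?mxE//; exact: L2_L1.
Qed.

(** The cross terms of the cost need two arguments; [qform M z] is convertible to [bil M z z]. *)
Definition bil m n (M : 'M[R]_(m, n)) (x : 'cV[R]_m) (y : 'cV[R]_n) : R :=
  (x^T *m M *m y) 0 0.

Lemma bilE m n (M : 'M[R]_(m, n)) x y :
  bil M x y = \sum_j \sum_i M i j * (x i 0 * y j 0).
Proof.
rewrite /bil mxE; apply: eq_bigr => j _; rewrite mxE mulr_suml.
by apply: eq_bigr => i _; rewrite mxE; ring.
Qed.

Lemma L1_bil m n (M : 'M[R]_(m, n)) X Y :
  L2vec Pr X -> L2vec Pr Y -> L1 Pr (fun w => bil M (X w) (Y w)).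
Proof.
move=> LX LY; under eq_fun do rewrite bilE.
by apply: L1_sum => j; apply: L1_sum => i; apply: L1Z; exact: L2_L1M.
Qed.

(** The product rule for entries is a hypothesis so that constant arguments and independent pairs
    are both covered. *)
Lemma Ex_bil m n (M : 'M[R]_(m, n)) X Y :
  L2vec Pr X -> L2vec Pr Y ->
  (forall i j, Ex Pr (fun w => X w i 0 * Y w j 0) =
               mean Pr X i 0 * mean Pr Y j 0) ->
  Ex Pr (fun w => bil M (X w) (Y w)) = bil M (mean Pr X) (mean Pr Y).
Proof.
move=> LX LY EXY; rewrite bilE; under [X in Ex _ X]eq_fun do rewrite bilE.
rewrite Ex_sum => [|j]; last first.
  by apply: L1_sum => i; apply: L1Z; exact: L2_L1M.
apply: eq_bigr => j _; rewrite Ex_sum => [|i]; last by apply: L1Z; exact: L2_L1M.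
by apply: eq_bigr => i _; rewrite ExZ ?EXY//; exact: L2_L1M.
Qed.

Lemma mean_cst n (a : 'cV[R]_n) : mean Pr (fun=> a) = a.
Proof. by apply/colP => i; rewrite mxE; exact: Ex_cst. Qed.

Lemma Ex_bil_cst m n (M : 'M[R]_(m, n)) a Y : L2vec Pr Y ->
  Ex Pr (fun w => bil M a (Y w)) = bil M a (mean Pr Y).
Proof.
move=> LY; rewrite -[in RHS](mean_cst a).
apply: (Ex_bil M (L2vec_cst a) LY) => i j; rewrite mean_cst mxE -[RHS]ExZ//.
exact: L2_L1.
Qed.

End SecondMoments.

Section IndependentExpectation.
Context d (T : measurableType d) (R : realType) (Pr : probability T R).
Variables (n m : nat) (Y : T -> 'cV[R]_n) (Z : T -> 'cV[R]_m).
Hypotheses (LY : L2vec Pr Y) (LZ : L2vec Pr Z) (YZ : indep_vec Pr Y Z).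

Lemma ge0_indep_integralM (u : vec R n -> R) (v : vec R m -> R) :
  measurable_fun setT u -> measurable_fun setT v ->
  (forall y, 0 <= u y) -> (forall z, 0 <= v z) ->
  (\int[Pr]_w (u (Y w) * v (Z w))%:E =
   (\int[Pr]_w (u (Y w))%:E) * (\int[Pr]_w (v (Z w))%:E))%E.
Proof.
move=> mu mv u0 v0.
have muY : measurable_fun setT (fun w => u (Y w)).
  exact: (measurableT_comp mu ((random_vecP Pr Y).1 LY.1)).
have mvZ : measurable_fun setT (fun w => v (Z w)).
  exact: (measurableT_comp mv ((random_vecP Pr Z).1 LZ.1)).
have /= := @indep_integral _ _ _ Pr _ _ Y Z LY.1 LZ.1 YZ
  (fun p => (u p.1 * v p.2)%:E).
move=> ->; last 2 first.
- apply/measurable_EFinP; apply: measurable_funM.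
    exact: (measurableT_comp mu measurable_fst).
  exact: (measurableT_comp mv measurable_snd).
- by move=> p; rewrite lee_fin mulr_ge0.
have emv : measurable_fun setT (fun w => (v (Z w))%:E) by exact/measurable_EFinP.
have emu : measurable_fun setT (fun w => (u (Y w))%:E) by exact/measurable_EFinP.
have ev0 w : [set: T] w -> (0 <= (v (Z w))%:E)%E by rewrite lee_fin.
have eu0 w : [set: T] w -> (0 <= (u (Y w))%:E)%E by rewrite lee_fin.
rewrite -(ge0_integralZr Pr measurableT emu eu0); last exact: integral_ge0.
apply: eq_integral => w _ /=.
rewrite -(ge0_integralZl Pr measurableT emv ev0); last by rewrite lee_fin.
by apply: eq_integral => w' _; rewrite EFinM.
Qed.

(** Tonelli handles nonnegative factors only, so each factor is split into its positive and negative
    parts [p] and [q], which are dominated by the absolute value and hence integrable. *)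
Lemma indep_Ex i j :
  Ex Pr (fun w => Y w i 0 * Z w j 0) = mean Pr Y i 0 * mean Pr Z j 0.
Proof.
pose p (x : R) := Num.max x 0; pose q (x : R) := Num.max (- x) 0.
have pq x : x = p x - q x.
  rewrite /p /q; case/orP: (le_total 0 x) => x0.
    by rewrite max_l// max_r ?oppr_le0// subr0.
  by rewrite max_r// max_l ?oppr_ge0// sub0r opprK.
have p0 x : 0 <= p x by rewrite /p le_max lexx orbT.
have q0 x : 0 <= q x by rewrite /q le_max lexx orbT.
have px x : `|p x| <= `|x|.
  by rewrite ger0_norm// /p ge_max ler_norm normr_ge0.
have qx x : `|q x| <= `|x|.
  by rewrite ger0_norm// /q ge_max -normrN ler_norm normr_ge0.
have mp : measurable_fun setT p by apply: measurable_maxr.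
have mq : measurable_fun setT q by apply: measurable_maxr.
have mn k (h : R -> R) : measurable_fun setT h -> forall l,
    measurable_fun setT (fun y : vec R k => h (y l 0)).
  by move=> mh l; exact: (measurableT_comp mh (@measurable_entry R k l)).
have I1 k (X : T -> 'cV[R]_k) (LX : L2vec Pr X) (h : R -> R) l :
    measurable_fun setT h -> (forall x, `|h x| <= `|x|) ->
    L1 Pr (fun w => h (X w l 0)).
  move=> mh hx; apply: (@L1_le _ _ _ _ _ (fun w => `|X w l 0|)) => //.
    by apply: (measurableT_comp mh); exact: LX.1.
  exact: (integrable_norm (L2_L1 l LX)).
have key (g h : R -> R) : measurable_fun setT g -> measurable_fun setT h ->
    (forall x, `|g x| <= `|x|) -> (forall x, `|h x| <= `|x|) ->
    (forall x, 0 <= g x) -> (forall x, 0 <= h x) ->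
    Ex Pr (fun w => g (Y w i 0) * h (Z w j 0)) =
    Ex Pr (fun w => g (Y w i 0)) * Ex Pr (fun w => h (Z w j 0)).
  move=> mg mh gx hx g0 h0.
  rewrite [LHS]/Ex /Rintegral (ge0_indep_integralM (mn n g mg i) (mn m h mh j))//.
  by rewrite (L1_EFin (I1 _ _ LY _ i mg gx)) (L1_EFin (I1 _ _ LZ _ j mh hx)).
have I2 (g h : R -> R) : measurable_fun setT g -> measurable_fun setT h ->
    (forall x, `|g x| <= `|x|) -> (forall x, `|h x| <= `|x|) ->
    L1 Pr (fun w => g (Y w i 0) * h (Z w j 0)).
  move=> mg mh gx hx.
  apply: (@L1_le _ _ _ _ _ (fun w => `|Y w i 0 * Z w j 0|)) => //.
  - apply: measurable_funM; first by apply: (measurableT_comp mg); exact: LY.1.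
    by apply: (measurableT_comp mh); exact: LZ.1.
  - by move=> w; rewrite !normrM ler_pM.
  - exact: (integrable_norm (L2_L1M i j LY LZ)).
rewrite !mxE -![Rintegral _ _ _]/(Ex Pr _).
have E1 k (X : T -> 'cV[R]_k) (LX : L2vec Pr X) l : Ex Pr (fun w => X w l 0) =
    Ex Pr (fun w => p (X w l 0)) + (- 1) * Ex Pr (fun w => q (X w l 0)).
  rewrite -ExZ ?I1// -ExD ?I1//; last by apply: L1Z; exact: I1.
  by congr (Ex Pr _); apply/funext => w; rewrite [LHS]pq; ring.
rewrite (E1 _ _ LY) (E1 _ _ LZ).
rewrite (_ : (fun w => Y w i 0 * Z w j 0) = fun w =>
  (p (Y w i 0) * p (Z w j 0) + (-1) * (p (Y w i 0) * q (Z w j 0))) +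
  ((-1) * (q (Y w i 0) * p (Z w j 0)) + q (Y w i 0) * q (Z w j 0))); last first.
  by apply/funext => w; rewrite [in LHS](pq (Y w i 0)) [in LHS](pq (Z w j 0)); ring.
rewrite !ExD ?ExZ ?key//; first ring.
all: repeat (first [apply: L1D | apply: L1Z | exact: I2]).
Qed.

Lemma indep_Ex_bil (M : 'M[R]_(n, m)) :
  Ex Pr (fun w => bil M (Y w) (Z w)) = bil M (mean Pr Y) (mean Pr Z).
Proof. by apply: Ex_bil => // i j; exact: indep_Ex. Qed.

End IndependentExpectation.

(** * The cost identity *)

Section BilinearForms.
Variable R : realType.

Lemma bilDl m n (M : 'M[R]_(m, n)) x x' y : bil M (x + x') y = bil M x y + bil M x' y.
Proof. by rewrite /bil linearD /= !mulmxDl mxE. Qed.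

Lemma bilDr m n (M : 'M[R]_(m, n)) x y y' : bil M x (y + y') = bil M x y + bil M x y'.
Proof. by rewrite /bil mulmxDr mxE. Qed.

Lemma bilNl m n (M : 'M[R]_(m, n)) x y : bil M (- x) y = - bil M x y.
Proof. by rewrite /bil linearN /= !mulNmx mxE. Qed.

Lemma bilNr m n (M : 'M[R]_(m, n)) x y : bil M x (- y) = - bil M x y.
Proof. by rewrite /bil mulmxN mxE. Qed.

Lemma bilDm m n (M N : 'M[R]_(m, n)) x y : bil (M + N) x y = bil M x y + bil N x y.
Proof. by rewrite /bil mulmxDr mulmxDl mxE. Qed.

Lemma bilNm m n (M : 'M[R]_(m, n)) x y : bil (- M) x y = - bil M x y.
Proof. by rewrite /bil mulmxN mulNmx mxE. Qed.

Lemma bil_mull m n p (M : 'M[R]_(m, n)) (A : 'M[R]_(m, p)) x y :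
  bil M (A *m x) y = bil (A^T *m M) x y.
Proof. by rewrite /bil trmx_mul !mulmxA. Qed.

Lemma bil_mulr m n p (M : 'M[R]_(m, n)) (A : 'M[R]_(n, p)) x y :
  bil M x (A *m y) = bil (M *m A) x y.
Proof. by rewrite /bil !mulmxA. Qed.

Lemma bilC m n (M : 'M[R]_(m, n)) x y : bil M x y = bil M^T y x.
Proof.
have -> : bil M x y = (y^T *m M^T *m x)^T 0 0.
  by rewrite !trmx_mul !trmxK mulmxA.
by rewrite mxE.
Qed.

Lemma bil_sqrB n (M : 'M[R]_n) x y : M^T = M ->
  bil M (x - y) (x - y) = bil M x x - 2 * bil M y x + bil M y y.
Proof.
move=> symM; rewrite bilDl !bilDr !bilNl !bilNr [bil M x y]bilC symM; ring.
Qed.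

Lemma pd_unitmx n (M : 'M[R]_n) : pd M -> M \in unitmx.
Proof.
move=> [_ pM]; rewrite -row_free_unit -kermx_eq0; apply/negP => /negP/rowV0Pn[v].
move=> /sub_kermxP vM v0; have := pM v^T; rewrite trmx_eq0 => /(_ v0).
by rewrite /qform trmxK vM mul0mx mxE ltxx.
Qed.

Lemma measurable_qform n (M : 'M[R]_n) :
  measurable_fun setT (fun v : vec R n => qform M v).
Proof.
rewrite (_ : (fun v => _) =
    fun v : vec R n => \sum_j \sum_i M i j * (v i 0 * v j 0)); last first.
  by apply/funext => v; exact: bilE.
apply: measurable_sum => j; apply: measurable_sum => i.
apply: measurable_funM; first exact: measurable_cst.
by apply: measurable_funM; exact: measurable_entry.
Qed.

End BilinearForms.

Section CostIdentity.
Variables (R : realType) (nx nu nw : nat).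
Variables (A : 'M[R]_nx) (B : 'M[R]_(nx, nu)) (E : 'M[R]_(nx, nw)).
Variables (Q : 'M[R]_nx) (Rm : 'M[R]_nu) (P : 'M[R]_nx) (G : 'M[R]_(nx, nw)).
Hypotheses (hR : pd Rm) (hP : psd P) (hD : dare A B Q Rm P).
Let K := lqK A B Rm P.
Let F := lqF B E Rm P G.
Let At := A + B *m K.
Let S := Rm + B^T *m P *m B.
Hypothesis hG : G = At^T *m (P *m E + G).

Let symP : P^T = P. Proof. exact: hP.1. Qed.
Let symS : S^T = S.
Proof. by rewrite linearD /= hR.1 !trmx_mul trmxK symP mulmxA. Qed.

Lemma pd_lqS : pd S.
Proof.
split=> // z z0; rewrite -[qform _ _]/(bil S z z) bilDm ltr_pwDl//; first exact: hR.2.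
have -> : bil (B^T *m P *m B) z z = bil P (B *m z) (B *m z).
  by rewrite bil_mull bil_mulr.
exact: hP.2.
Qed.

Let unitS : S \in unitmx. Proof. exact: (pd_unitmx pd_lqS). Qed.

Let SK : S *m K = - (B^T *m P *m A).
Proof. by rewrite /K /lqK mulmxN -/S !mulmxA mulmxV// mul1mx. Qed.

Let SF : S *m F = - (B^T *m (P *m E + G)).
Proof. by rewrite /F /lqF mulmxN -/S !mulmxA mulmxV// mul1mx. Qed.

Let dareK : P = Q + A^T *m P *m A - K^T *m S *m K.
Proof.
have -> : K^T *m S *m K = A^T *m P *m B *m invmx S *m B^T *m P *m A.
  rewrite -[K^T *m S *m K]mulmxA SK mulmxN /K /lqK -/S linearN /= mulNmx opprK.
  by rewrite !trmx_mul trmxK trmx_inv symS symP !mulmxA.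
by rewrite [LHS]hD -/S mulmxBr mulmxBl !mulmxA addrA.
Qed.

(** One step of dynamic programming with [P] as value function: the terms free of [w] complete the
    square by the Riccati equation. The cross term in [w] is left alone, since it simplifies only in
    expectation. *)
Lemma lq_complete_square x u w :
  bil Q x x + bil Rm u u
    + bil P (A *m x + B *m u + E *m w) (A *m x + B *m u + E *m w) =
  bil P x x + bil S (u - K *m x) (u - K *m x)
    + 2 * bil (P *m E) (A *m x + B *m u) w + bil (E^T *m P *m E) w w.
Proof.
have EP : bil P x x = bil Q x x + bil (A^T *m P *m A) x x - bil (K^T *m S *m K) x x.
  by rewrite {1}dareK !bilDm bilNm.
rewrite EP !(bilDl, bilDr, bilNl, bilNr).
have -> : bil P (B *m u) (A *m x) = bil P (A *m x) (B *m u) by rewrite bilC symP.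
have -> : bil P (E *m w) (A *m x) = bil P (A *m x) (E *m w) by rewrite bilC symP.
have -> : bil P (E *m w) (B *m u) = bil P (B *m u) (E *m w) by rewrite bilC symP.
have -> : bil S (K *m x) u = bil S u (K *m x) by rewrite bilC symS.
have -> : bil S u (K *m x) = - bil P (A *m x) (B *m u).
  rewrite bil_mulr SK bilNm; congr (- _).
  by rewrite [RHS]bilC symP bil_mull bil_mulr.
have -> : bil S u u = bil Rm u u + bil P (B *m u) (B *m u).
  by rewrite bilDm bil_mull bil_mulr.
rewrite !(bil_mull, bil_mulr) !mulmxA.
ring.
Qed.

(** The equation of [G] turns the pairing of [P E] with [At x] into that of [G] with
    [x - At x = B v + E m], where [v = u - K x]. The terms in [v] cancel those coming from [S F],
    and only [m] remains. *)
Lemma lq_stationary_mean x u m : x = A *m x + B *m u + E *m m ->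
  2 * bil (P *m E) (A *m x + B *m u) m + 2 * bil S (u - K *m x) (F *m m)
    - bil S (F *m m) (F *m m) = qform (deltaS B E Rm P G) m.
Proof.
move=> hx; pose v := u - K *m x.
have xE : x = At *m x + B *m v + E *m m.
  rewrite {1}hx /v /At mulmxDl mulmxBr !mulmxA; congr (_ + _).
  by rewrite addrACA subrr addr0.
have GE y : bil (P *m E) (At *m y) m = bil G y m - bil G (At *m y) m.
  by rewrite {1}hG mulmxDr bilDm !bil_mull addrK.
have -> : A *m x + B *m u = At *m x + B *m v.
  apply: (addIr (E *m m)); rewrite -hx; exact: xE.
have -> : bil S (u - K *m x) (F *m m) = - bil (P *m E) (B *m v) m - bil G (B *m v) m.
  by rewrite bil_mulr SF bilNm mulmxDr bilDm -!bil_mull opprD.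
have -> : bil (P *m E) (At *m x + B *m v) m =
    bil G (B *m v) m + bil G (E *m m) m + bil (P *m E) (B *m v) m.
  rewrite bilDl GE; congr (_ + _); rewrite -bilNl -bilDl.
  have -> : x - At *m x = B *m v + E *m m.
    by apply/eqP; rewrite subr_eq addrC addrA -xE.
  by rewrite bilDl.
rewrite -[qform _ _]/(bil _ m m) /deltaS -/F -/S.
rewrite [RHS]bilDm [bil (- _) m m]bilNm [X in _ = X + _]bilDm.
rewrite [bil (G^T *m E) m m]bilC trmx_mul trmxK !(bil_mull, bil_mulr) !mulmxA.
ring.
Qed.

End CostIdentity.

Section SquaredNorm.
Variable R : realType.
Context dW (TW : measurableType dW) (PW : probability TW R).
Context d (T : measurableType d) (Pr : probability T R).

Lemma same_law_L2 n (Y : T -> 'cV[R]_n) (Y0 : TW -> 'cV[R]_n) :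
  random_vec Pr Y -> same_law Pr PW Y Y0 -> L2vec PW Y0 -> L2vec Pr Y.
Proof.
move=> mY YY0 L0; split=> // i.
have mf : measurable_fun setT (fun v : vec R n => ((v i 0) ^+ 2)%:E).
  apply/measurable_EFinP; apply: measurable_funX; exact: measurable_entry.
exact: (same_law_integrable mY L0.1 YY0 mf (L0.2 i)).
Qed.

Lemma sqnormE n (M : 'M[R]_n) (Y : T -> 'cV[R]_n) : L2vec Pr Y ->
  sqnorm Pr M Y = (Ex Pr (fun w => bil M (Y w) (Y w)))%:E.
Proof. by move=> LY; rewrite -L1_EFin//; exact: L1_bil. Qed.

End SquaredNorm.

Lemma same_law_sqnorm (R : realType) n (M : 'M[R]_n)
    d1 (T1 : measurableType d1) (Pr1 : probability T1 R)
    d2 (T2 : measurableType d2) (Pr2 : probability T2 R)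
    (Y1 : T1 -> 'cV[R]_n) (Y2 : T2 -> 'cV[R]_n) :
  random_vec Pr1 Y1 -> random_vec Pr2 Y2 -> same_law Pr1 Pr2 Y1 Y2 ->
  sqnorm Pr1 M Y1 = sqnorm Pr2 M Y2.
Proof.
move=> m1 m2 Y12.
apply: (same_law_integral (f := fun v : vec R n => (qform M v)%:E) m1 m2 Y12).
by apply/measurable_EFinP; exact: measurable_qform.
Qed.

Lemma same_law_mean (R : realType) n
    d1 (T1 : measurableType d1) (Pr1 : probability T1 R)
    d2 (T2 : measurableType d2) (Pr2 : probability T2 R)
    (Y1 : T1 -> 'cV[R]_n) (Y2 : T2 -> 'cV[R]_n) :
  random_vec Pr1 Y1 -> random_vec Pr2 Y2 -> same_law Pr1 Pr2 Y1 Y2 ->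
  mean Pr1 Y1 = mean Pr2 Y2.
Proof.
move=> m1 m2 Y12; apply/colP => i; rewrite !mxE; congr fine.
apply: (same_law_integral (f := fun v : vec R n => (v i 0)%:E) m1 m2 Y12).
by apply/measurable_EFinP; exact: measurable_entry.
Qed.

Section StationaryCost.
Variables (R : realType) (nx nu nw : nat).
Variables (A : 'M[R]_nx) (B : 'M[R]_(nx, nu)) (E : 'M[R]_(nx, nw)).
Variables (Q : 'M[R]_nx) (Rm : 'M[R]_nu) (P : 'M[R]_nx) (G : 'M[R]_(nx, nw)).
Hypotheses (hR : pd Rm) (hP : psd P) (hD : dare A B Q Rm P).
Let K := lqK A B Rm P.
Let F := lqF B E Rm P G.
Let S := Rm + B^T *m P *m B.
Hypothesis hG : G = (A + B *m K)^T *m (P *m E + G).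
Context dW (TW : measurableType dW) (PW : probability TW R) (W : TW -> 'cV[R]_nw).
Hypothesis hW : L2vec PW W.
Context d (T : measurableType d) (Pr : probability T R).
Variables (X : T -> 'cV[R]_nx) (U : T -> 'cV[R]_nu).

Let m := mean PW W.
Let dev w := U w - K *m X w - F *m m.

Lemma L2_lqdev : L2vec Pr X -> L2vec Pr U -> L2vec Pr dev.
Proof.
move=> LX LU; rewrite /dev.
under eq_fun do rewrite -mulNmx.
by apply: L2vecD; [apply: L2vecD => //; exact: L2vecM | exact: L2vec_cst].
Qed.

(** In expectation the two [P] terms cancel by equality in law, and independence reduces the cross
    term to means. Recentring [U - K X] at [F m] produces exactly the terms evaluated by
    [lq_stationary_mean]. *)
Lemma stat_cost_dev : stat_feasible A B E PW W Pr X U ->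
  (stat_cost Q Rm Pr X U = sqnorm PW (E^T *m P *m E) W
     + (qform (deltaS B E Rm P G) m)%:E
     + (Ex Pr (fun w => qform S (dev w)))%:E)%E.
Proof.
move=> [LX [LU [W' [mW' [W'W [ind law]]]]]].
have LW' : L2vec Pr W' := same_law_L2 mW' W'W hW.
pose AB w := A *m X w + B *m U w.
have LAB : L2vec Pr AB by apply: L2vecD; exact: L2vecM.
pose X' w := AB w + E *m W' w.
have LX' : L2vec Pr X' by apply: L2vecD => //; exact: L2vecM.
have mW : mean Pr W' = m by exact: same_law_mean mW' hW.1 W'W.
have mX' : mean Pr X = A *m mean Pr X + B *m mean Pr U + E *m m.
  rewrite {1}(same_law_mean LX.1 LX'.1 law) meanD//; last exact: L2vecM.
  by rewrite meanD ?meanM ?mW//; exact: L2vecM.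
have LV : L2vec Pr (fun w => U w - K *m X w).
  by under eq_fun do rewrite -mulNmx; apply: L2vecD => //; exact: L2vecM.
have mV : mean Pr (fun w => U w - K *m X w) = mean Pr U - K *m mean Pr X.
  under [X in mean _ X]eq_fun do rewrite -mulNmx.
  by rewrite meanD ?meanM ?mulNmx//; exact: L2vecM.
have Ldev := L2_lqdev LX LU.
have mdev : mean Pr dev = mean Pr U - K *m mean Pr X - F *m m.
  by rewrite /dev meanD ?mV ?mean_cst//; exact: L2vec_cst.
have EX : Ex Pr (fun w => bil P (X w) (X w)) = Ex Pr (fun w => bil P (X' w) (X' w)).
  apply: EFin_inj; rewrite -!sqnormE//; exact: same_law_sqnorm LX.1 LX'.1 law.
have EW : Ex Pr (fun w => bil (E^T *m P *m E) (W' w) (W' w)) =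
          Ex PW (fun w => bil (E^T *m P *m E) (W w) (W w)).
  apply: EFin_inj; rewrite -!sqnormE//; exact: same_law_sqnorm mW' hW.1 W'W.
(* Independence is given for the stacked vector, so [A X + B U] is written as a linear image of
   it. *)
have ABE w : AB w = row_mx A B *m col_mx (X w) (U w) by rewrite mul_row_col.
have LXU : L2vec Pr (fun w => col_mx (X w) (U w)).
  split; first exact: (random_vec_col LX.1 LU.1).
  move=> i; under eq_fun do rewrite mxE.
  by case: (fintype.split i) => j; [exact: LX.2 | exact: LU.2].
have Ecross : Ex Pr (fun w => bil (P *m E) (AB w) (W' w)) =
    bil (P *m E) (A *m mean Pr X + B *m mean Pr U) m.
  transitivity (Ex Pr (fun w => bil ((row_mx A B)^T *m (P *m E))
                                    (col_mx (X w) (U w)) (W' w))).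
    by congr (Ex Pr _); apply/funext => w; rewrite ABE bil_mull.
  rewrite (indep_Ex_bil LXU LW' ind) mW -bil_mull -meanM//.
  rewrite -[in RHS]meanM// -[in RHS](meanM B LU) -meanD; [|exact: L2vecM..].
  by congr (bil _ (mean Pr _) _); apply/funext => w; rewrite -ABE.
pose D := qform S (F *m m).
(* Nested to the right, so that [ExD] and [ExZ] later peel off one term at a time. *)
have pt w : bil Q (X w) (X w) + bil Rm (U w) (U w) =
    qform S (dev w) + (2 * bil S (F *m m) (U w - K *m X w) + (- D
    + (2 * bil (P *m E) (AB w) (W' w) + (bil (E^T *m P *m E) (W' w) (W' w)
    + (bil P (X w) (X w) + (-1) * bil P (X' w) (X' w)))))).
  have := lq_complete_square E hR hP hD (X w) (U w) (W' w).
  rewrite -/K -/S -/(AB w) -/(X' w) => H.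
  have symS : S^T = S by have [] := pd_lqS B hR hP.
  rewrite -[qform S (dev w)]/(bil S (dev w) (dev w)) /dev bil_sqrB// /D.
  rewrite -[qform S (F *m m)]/(bil S (F *m m) (F *m m)).
  lra.
rewrite /stat_cost !sqnormE// -!EFinD -ExD; try exact: L1_bil.
rewrite (funext pt).
have L1dev : L1 Pr (fun w => qform S (dev w)) by exact: L1_bil.
have L1F : L1 Pr (fun w => bil S (F *m m) (U w - K *m X w)).
  exact: (L1_bil S (L2vec_cst Pr (F *m m)) LV).
have L1c := L1_bil (P *m E) LAB LW'.
have L1e := L1_bil (E^T *m P *m E) LW' LW'.
have L1p := L1_bil P LX LX; have L1p' := L1_bil P LX' LX'.
have L1D' : L1 Pr (fun=> - D) by exact: L1_cst.
rewrite ExD//; last by do ?[apply: L1D | apply: L1Z | by []].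
rewrite ExD ?ExZ//; [|exact: L1Z|by do ?[apply: L1D | apply: L1Z | by []]].
rewrite ExD ?Ex_cst//; last by do ?[apply: L1D | apply: L1Z | by []].
rewrite ExD ?ExZ//; [|exact: L1Z|by do ?[apply: L1D | apply: L1Z | by []]].
rewrite ExD//; last by apply: L1D => //; exact: L1Z.
rewrite ExD ?ExZ//; last exact: L1Z.
rewrite EX EW Ecross (Ex_bil_cst S (F *m m) LV) mV.
congr EFin.
rewrite -(lq_stationary_mean hR hP hG mX') -/K -/F -/S.
have symS : S^T = S by have [] := pd_lqS B hR hP.
rewrite [bil S (mean Pr U - _) (F *m m)]bilC symS /D -[qform S (F *m m)]/(bil S _ _).
ring.
Qed.

End StationaryCost.

(** * Uniqueness of the stationary law *)

Section LawDetermination.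
Variable R : realType.

Lemma bounded_cvg_integral d (T : measurableType d) (Pr : probability T R)
    (u : nat -> T -> R) (l : T -> R) :
  (forall N, measurable_fun setT (u N)) -> measurable_fun setT l ->
  (forall N w, 0 <= u N w <= 1) ->
  {ae Pr, forall w, (fun N => u N w) @ \oo --> l w} ->
  (fun N => \int[Pr]_w (u N w)%:E)%E @ \oo --> (\int[Pr]_w (l w)%:E)%E.
Proof.
move=> mu ml u01 ul.
have [] // := @dominated_convergence _ T R Pr setT measurableT
  (fun N w => (u N w)%:E) (fun w => (l w)%:E) (cst 1%E).
- by move=> N; exact/measurable_EFinP.
- exact/measurable_EFinP.
- by apply: filterS ul => w uw _; apply: cvg_EFin => //; apply: nearW.
- exact: finite_measure_integrable_cst.
- apply: aeW => w N _ /=; have /andP[u0 u1] := u01 N w.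
  by rewrite lee_fin ger0_norm.
Qed.

(* Test functions determining a law on [vec R n]; continuity is only along
   entrywise convergent sequences. *)
Definition test_fun n (f : vec R n -> R) :=
  [/\ measurable_fun setT f, forall v, 0 <= f v <= 1 &
      forall (u : nat -> vec R n) (l : vec R n),
        (forall i, (fun N => u N i 0 : R) @ \oo --> (l i 0 : R)) ->
        (fun N => f (u N)) @ \oo --> f l].

Lemma test_funM n (f g : vec R n -> R) :
  test_fun f -> test_fun g -> test_fun (fun v => f v * g v).
Proof.
move=> [mf f01 cf] [mg g01 cg]; split; first exact: measurable_funM.
  move=> v; have /andP[f0 f1] := f01 v; have /andP[g0 g1] := g01 v.
  by rewrite mulr_ge0//= mulr_ile1.
by move=> u l ul; apply: cvgM; [exact: cf | exact: cg].
Qed.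

Lemma test_fun1 n : @test_fun n (fun=> 1).
Proof.
split; [exact: measurable_cst | by move=> v; rewrite ler01 lexx |].
by move=> u l _; exact: cvg_cst.
Qed.

Lemma test_funX n (f : vec R n -> R) k :
  test_fun f -> test_fun (fun v => f v ^+ k).
Proof.
move=> tf; elim: k => [|k IH]; first exact: test_fun1.
by under eq_fun do rewrite exprS; exact: test_funM.
Qed.

(* [exp (- 2 max(a - v_i, 0))], equal to 1 exactly when [a <= v_i]. *)
Definition halfspace_fun n i (a : R) (v : vec R n) : R :=
  expR (- (`|a - v i 0| + (a - v i 0))).

Lemma halfspace_test_fun n i a : test_fun (@halfspace_fun n i a).
Proof.
have md : measurable_fun setT (fun v : vec R n => a - v i 0).
  apply: measurable_funB; [exact: measurable_cst | exact: measurable_entry].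
split.
- apply: (measurableT_comp (@measurable_expR R)).
  apply: measurableT_comp => //; apply: measurable_funD => //.
  exact: (measurableT_comp _ md).
- move=> v; rewrite expR_ge0/= -[leRHS]expR0 ler_expR oppr_le0.
  have := ler_norm (- (a - v i 0)); rewrite normrN; lra.
- move=> u l ul.
  apply: (@cvg_comp _ _ _ (fun N => - (`|a - u N i 0| + (a - u N i 0))) (@expR R)
    _ _ _ _ (@continuous_expR R _)).
  have cd : (fun N => a - (u N i 0 : R)) @ \oo --> a - l i 0.
    by apply: cvgB; [exact: cvg_cst | exact: ul].
  by apply: cvgN; apply: cvgD => //; exact: cvg_norm.
Qed.

(** By bounded convergence, the integrals of test functions determine the probability of such a
    set. *)
Definition test_set n (S : set (vec R n)) := measurable S /\
  exists2 f : nat -> vec R n -> R, forall k, test_fun (f k) &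
    forall v, (fun k => f k v) @ \oo --> (\1_S v : R).

(** The powers of [halfspace_fun] stay equal to 1 on the half-space and tend to 0 off it. *)
Lemma halfspace_test_set n i a : @test_set n [set v | a <= v i 0].
Proof.
split.
  suff <- : (fun v : vec R n => v i 0) @^-1` `[a, +oo[%classic =
      [set v | a <= v i 0].
    by rewrite -[X in measurable X]setTI; exact: measurable_entry.
  by apply/seteqP; split => v /=; rewrite in_itv /= andbT.
exists (fun k v => halfspace_fun i a v ^+ k).
  by move=> k; apply: test_funX; exact: halfspace_test_fun.
move=> v; rewrite indicE; case: (boolP (v \in _)) => /=; rewrite ?inE ?notin_setE /=.
  move=> av; rewrite /halfspace_fun ler0_norm ?subr_le0// addNr oppr0 expR0.
  by under eq_fun do rewrite expr1n; exact: cvg_cst.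
move=> /negP; rewrite -ltNge => va; apply: cvg_expr.
rewrite ger0_norm ?expR_ge0// /halfspace_fun -[ltRHS]expR0 ltr_expR.
have := ler_norm (a - v i 0); lra.
Qed.

Lemma test_setI n : setI_closed (@test_set n).
Proof.
move=> S S' [mS [f tf fS]] [mS' [g tg gS']]; split; first exact: measurableI.
exists (fun k v => f k v * g k v); first by move=> k; exact: test_funM.
move=> v; rewrite indicI; exact: cvgM.
Qed.

Lemma test_setT n : @test_set n setT.
Proof.
split; first exact: measurableT.
exists (fun _ _ => 1); first by move=> _; exact: test_fun1.
by move=> v; rewrite indicT; exact: cvg_cst.
Qed.

Lemma measurable_test_set n (S : set (vec R n)) :
  measurable S -> <<s @test_set n >> S.
Proof.
suff : @measurable _ (vec R n) `<=` <<s @test_set n >> by exact.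
apply: smallest_sub; first exact: smallest_sigma_algebra.
move=> _ [i [A [mA ->]]].
have : measurable_fun setT
    (fun v : g_sigma_algebraType (@test_set n) => v i 0 : R).
  apply: (measurability (@RGenCInfty.G R) (RGenCInfty.measurableE R)).
  move=> _ [_ [a ->] <-]; rewrite setTI; apply: sub_sigma_algebra.
  rewrite (_ : _ @^-1` _ = [set v : vec R n | a <= v i 0]).
    exact: halfspace_test_set.
  by apply/seteqP; split => v /=; rewrite in_itv /= andbT.
by move=> /(_ measurableT A mA); rewrite setTI.
Qed.

(** Test sets are closed under intersection, because test functions are closed under products, and
    they generate the Borel sets; two probabilities equal on them coincide. *)
Lemma test_fun_same_law d1 (T1 : measurableType d1) (Pr1 : probability T1 R)
    d2 (T2 : measurableType d2) (Pr2 : probability T2 R) n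
    (X : T1 -> 'cV[R]_n) (Y : T2 -> 'cV[R]_n) :
  random_vec Pr1 X -> random_vec Pr2 Y ->
  (forall f, @test_fun n f ->
     \int[Pr1]_w (f (X w))%:E = \int[Pr2]_w (f (Y w))%:E)%E ->
  same_law Pr1 Pr2 X Y.
Proof.
move=> /random_vecP mX /random_vecP mY XY S mS.
rewrite -[LHS](image_probabilityE Pr1 mX) -[RHS](image_probabilityE Pr2 mY).
apply: (@g_sigma_algebra_measure_unique _ R (vec R n) (@test_set n) _
  (fun=> setT) _ _ (image_probability Pr1 mX) (image_probability Pr2 mY)).
- by move=> A [].
- by move=> _; exact: test_setT.
- by rewrite bigcup_const//; exists 0%N.
- exact: test_setI.
- move=> A [mA [f tf fA]].
  have cvgi d (T : measurableType d) (Pr : probability T R) (Z : T -> vec R n)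
      (mZ : measurable_fun setT Z) :
      (fun k => \int[Pr]_w (f k (Z w))%:E)%E @ \oo --> Pr (Z @^-1` A).
    have mZA : measurable (Z @^-1` A).
      by rewrite -[X in measurable X]setTI; exact: mZ.
    rewrite -[Z @^-1` A]setIT -integral_indic//.
    apply: (@bounded_cvg_integral _ _ Pr (fun k w => f k (Z w))
      (fun w => \1_(Z @^-1` A) w)).
    + by move=> k; have [mf _ _] := tf k; exact: (measurableT_comp mf mZ).
    + exact: measurable_indic.
    + by move=> k w; have [_ f01 _] := tf k; exact: f01.
    + by apply: aeW => w; exact: fA.
  have c1 := cvgi _ _ Pr1 _ mX; have c2 := cvgi _ _ Pr2 _ mY.
  apply: (cvg_unique _ c1 _) => //.
  rewrite (_ : (fun k => _) = fun k => \int[Pr2]_w (f k (Y w))%:E)%E//.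
  by apply/funext => k; exact: XY.
- by move=> _; rewrite /= [X in (X < _)%E]probability_setT ltry.
- exact: measurable_test_set.
Qed.

End LawDetermination.

(** * Independence of a term of an i.i.d. sequence from its past *)

Section IidIndependence.
Variable R : realType.
Context d (T : measurableType d) (Pr : probability T R).
Context dW (TW : measurableType dW) (PW : probability TW R).
Variables (n : nat) (Wj : nat -> T -> 'cV[R]_n) (W : TW -> 'cV[R]_n).
Hypothesis iid : iid_copies Pr PW Wj W.

Let mWj j : measurable_fun setT (Wj j : T -> vec R n) :=
  (random_vecP Pr (Wj j)).1 (iid.1 j).1.

Definition past_gen N : set (set T) :=
  [set A | exists2 S : nat -> set 'cV[R]_n, forall j, mxBorel (S j) &
             A = \bigcap_(j in [set` iota 0 N]) (Wj j @^-1` S j)].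

Let measurable_past N : past_gen N `<=` measurable.
Proof.
move=> _ [S mS ->]; apply: bigcap_measurableType => j _.
by rewrite -[X in measurable X]setTI; apply: mWj => //; exact: mS.
Qed.

Let past_setI N : setI_closed (past_gen N).
Proof.
move=> _ _ [S mS ->] [S' mS' ->]; exists (fun j => S j `&` S' j).
  by move=> j; apply: (@measurableI _ (vec R n)); [exact: mS | exact: mS'].
by rewrite -bigcapI; apply: eq_bigcapr => j _; rewrite preimage_setI.
Qed.

Let past_setT N : past_gen N setT.
Proof.
exists (fun=> setT); first by move=> j; exact: (@measurableT _ (vec R n)).
by apply/seteqP; split.
Qed.

(** For fixed [S], both sides are finite measures in [A]: a restriction and a multiple of [Pr]. They
    agree on [past_gen N], which is closed under intersection. *)
Lemma iid_indep_past N S A : mxBorel S -> <<s past_gen N >> A ->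
  (Pr (Wj N @^-1` S `&` A) = Pr (Wj N @^-1` S) * Pr A)%E.
Proof.
move=> mS sA; set D := Wj N @^-1` S.
have mD : measurable D by rewrite -[X in measurable X]setTI; exact: mWj.
have p0 : 0 <= fine (Pr D) by rewrite fine_ge0.
have pE : Pr D = (fine (Pr D))%:E by rewrite fineK// fin_num_measure.
rewrite setIC.
rewrite -[LHS]/(mrestr Pr mD A) [X in (X * _)%E]pE -[RHS]/(mscale (NngNum p0) Pr A).
apply: (@g_sigma_algebra_measure_unique _ R T (past_gen N) _ (fun=> setT) _ _
  (mrestr Pr mD) (mscale (NngNum p0) Pr)).
- exact: measurable_past.
- by move=> _; exact: past_setT.
- by rewrite bigcup_const//; exists 0%N.
- exact: past_setI.
- move=> _ [S' mS' ->]; rewrite [RHS](_ : _ =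
    Pr D * Pr (\bigcap_(j in [set` iota 0 N]) (Wj j @^-1` S' j)))%E; last first.
    by rewrite [X in (X * _)%E]pE.
  (* The product rule is applied to the past with index [N] adjoined, where the prescribed set is
     [S]. *)
  have := iid.2 (N :: iota 0 N) (fun j => if j == N then S else S' j).
  rewrite /= mem_iota add0n ltnn /= iota_uniq => /(_ isT).
  have -> : \bigcap_(j in [set` N :: iota 0 N])
      (Wj j @^-1` (if j == N then S else S' j)) =
    \bigcap_(j in [set` iota 0 N]) (Wj j @^-1` S' j) `&` D.
    apply/seteqP; split => w.
      move=> H; split; last by have := H N; rewrite /= eqxx; apply; exact: mem_head.
      move=> j /= jN; have := H j; rewrite /= inE jN orbT => /(_ isT).
      by move: jN; rewrite mem_iota add0n => /ltn_eqF ->.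
    move=> [H DW] j /=; rewrite inE; have [->//|jN /= jn] := eqVneq j N.
    exact: H.
  move=> H.
  rewrite -[LHS]/(Pr (\bigcap_(j in [set` iota 0 N]) (Wj j @^-1` S' j) `&` D)) H;
    last by move=> j; case: ifP.
  rewrite big_cons eqxx -/D; congr (_ * _)%E.
  rewrite (iid.2 (iota 0 N) S' (iota_uniq 0 N) mS').
  rewrite big_seq [RHS]big_seq; apply: eq_bigr => j.
  by rewrite mem_iota add0n => /ltn_eqF ->.
- move=> _; apply: (@le_lt_trans _ _ 1%E); last exact: ltry.
  exact: (probability_le1 Pr (measurableI _ _ measurableT mD)).
- exact: sA.
Qed.

Lemma iid_indep_sum m (g : nat -> 'cV[R]_n -> 'cV[R]_m) N :
  (forall j, measurable_fun setT (g j : vec R n -> vec R m)) ->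
  indep_vec Pr (Wj N) (fun w => \sum_(j < N) g j (Wj j w)).
Proof.
move=> mg S S' mS mS'; apply: iid_indep_past => //.
pose TN := g_sigma_algebraType (past_gen N).
have mW (j : 'I_N) : measurable_fun setT (Wj j : TN -> vec R n).
  move=> _ B mB; rewrite setTI; apply: sub_sigma_algebra.
  exists (fun k : nat => if k == j :> nat then B else setT).
    by move=> k; case: ifP => // _; exact: (@measurableT _ (vec R n)).
  apply/seteqP; split => w.
    by move=> Bw k _ /=; case: eqP => [->|].
  move=> /(_ j); rewrite /= eqxx; apply.
  by rewrite mem_iota /= add0n.
have : measurable_fun setT
    (fun w : TN => \sum_(j < N) g j (Wj j w) : vec R m).
  apply/(random_vecP (\d_ (point : TN))).
  apply: random_vec_sum => j; apply/random_vecP.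
  exact: (measurableT_comp (mg j) (mW j)).
by move=> /(_ measurableT S' mS'); rewrite setTI.
Qed.

End IidIndependence.

Lemma indep_vec_sym (R : realType) d (T : measurableType d) (Pr : probability T R)
    n m (Y : T -> 'cV[R]_n) (Z : T -> 'cV[R]_m) :
  indep_vec Pr Y Z -> indep_vec Pr Z Y.
Proof. by move=> YZ S S' mS mS'; rewrite setIC muleC; exact: YZ. Qed.

Section StationaryLaw.
Variables (R : realType) (n nw : nat).
Variables (M : 'M[R]_n) (c : 'cV[R]_n) (E : 'M[R]_(n, nw)).
Context dW (TW : measurableType dW) (PW : probability TW R).
Variable W : TW -> 'cV[R]_nw.
Hypothesis mW : random_vec PW W.

Context d (T : measurableType d) (Pr : probability T R).
Variables (X : T -> 'cV[R]_n) (W' : T -> 'cV[R]_nw).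
Hypotheses (mX : random_vec Pr X) (mW' : random_vec Pr W').
Hypotheses (W'W : same_law Pr PW W' W) (XW' : indep_vec Pr X W').
Hypothesis statX : same_law Pr Pr X (fun w => M *m X w + (c + E *m W' w)).

Context d2 (T2 : measurableType d2) (Pr2 : probability T2 R).
Variable Wj : nat -> T2 -> 'cV[R]_nw.
Hypothesis iid : iid_copies Pr2 PW Wj W.

(** In law, the state reached from 0 after [N] steps. The inputs are numbered backwards in time, so
    that increasing [N] only adds a small term and the sums can converge almost surely. *)
Definition forced_sum N w := \sum_(j < N) M ^+ j *m (c + E *m Wj j w).

Let measurable_affine k : measurable_fun setT
  (fun v : vec R nw => M ^+ k *m (c + E *m v) : vec R n).
Proof.
apply: (measurableT_comp (measurable_mulmx (M ^+ k))).
apply: measurable_vecP => i; under eq_fun do rewrite mxE.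
apply: measurable_funD; first exact: measurable_cst.
exact: (measurableT_comp (measurable_entry i) (measurable_mulmx E)).
Qed.

Lemma random_vec_forced_sum N : random_vec Pr2 (forced_sum N).
Proof.
apply: random_vec_sum => j; apply/random_vecP.
apply: (measurableT_comp (measurable_affine j)).
by apply/(random_vecP Pr2); have [] := iid.1 j.
Qed.

Local Open Scope ereal_scope.

(** The [N]-step transition operator of the recursion, applied to [f]. *)
Let smooth (f : vec R n -> \bar R) N (x : vec R n) : \bar R :=
  \int[Pr2]_w f ((M ^+ N *m x + forced_sum N w)%R).

Let measurable_smooth_arg (f : vec R n -> \bar R) N : measurable_fun setT f ->
  measurable_fun setT
    (fun p : vec R n * T2 => f ((M ^+ N *m p.1 + forced_sum N p.2)%R)).
Proof.
move=> mf; apply: (measurableT_comp mf); apply: measurable_vecP => i.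
under eq_fun do rewrite mxE; apply: measurable_funD.
  apply: (measurableT_comp (measurable_entry i)).
  exact: (measurableT_comp (measurable_mulmx _) measurable_fst).
exact: (measurableT_comp (random_vec_forced_sum N i) measurable_snd).
Qed.

Let measurable_smooth f N : measurable_fun setT f -> (forall v, 0 <= f v) ->
  measurable_fun setT (smooth f N).
Proof.
move=> mf f0.
apply: (@measurable_fun_fubini_tonelli_F _ _ (vec R n) T2 R Pr2
  (fun p => f ((M ^+ N *m p.1 + forced_sum N p.2)%R))).
  exact: measurable_smooth_arg.
by move=> p.
Qed.

(** In the induction, [X] is replaced by [M X + c + E W'], and [W'] by [Wj N], which has the same
    law and is independent of [forced_sum N]. The new input thus becomes the last term of
    [forced_sum N.+1], with no shift of the sequence. *)
Lemma stationary_integral (f : vec R n -> \bar R) N : measurable_fun setT f -> (forall v, 0 <= f v) ->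
  \int[Pr]_w f (X w) =
  \int[Pr]_w \int[Pr2]_w2 f ((M ^+ N *m X w + forced_sum N w2)%R).
Proof.
move=> mf f0; rewrite -[RHS]/(\int[Pr]_w smooth f N (X w)).
elim: N => [|N IH].
  apply: eq_integral => w _; rewrite /smooth.
  under eq_integral do rewrite /forced_sum big_ord0 addr0 expr0 mul1mx.
  by rewrite integral_cst// [X in _ * X]probability_setT mule1.
rewrite IH.
have msm := measurable_smooth N mf f0.
have sm0 x : 0 <= smooth f N x by exact: integral_ge0.
have mstep : measurable_fun setT (fun p : vec R n * vec R nw =>
    ((M *m p.1 + (c + E *m p.2))%R : vec R n)).
  apply: measurable_vecP => i; under eq_fun do rewrite mxE.
  apply: measurable_funD.
    apply: (measurableT_comp (measurable_entry i)).
    exact: (measurableT_comp (measurable_mulmx _) measurable_fst).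
  have := measurable_affine 0; under eq_fun do rewrite expr0 mul1mx.
  move=> H; apply: (measurableT_comp (measurable_entry i)).
  exact: (measurableT_comp H measurable_snd).
have mXW : random_vec Pr (fun w => M *m X w + (c + E *m W' w))%R.
  apply/(random_vecP Pr).
  have mp := measurable_fun_pair ((random_vecP Pr X).1 mX) ((random_vecP Pr W').1 mW').
  exact: (measurableT_comp mstep mp).
rewrite (ge0_same_law_integral mX mXW statX msm sm0).
have mss := measurableT_comp msm mstep.
transitivity (\int[Pr]_w \int[Pr]_w' smooth f N (M *m X w + (c + E *m W' w'))%R).
  exact: (indep_integral mX mW' XW' mss (fun p => sm0 _)).
apply: eq_integral => w _ /=.
have mstepw : measurable_fun setT
    (fun v : vec R nw => (M *m X w + (c + E *m v))%R : vec R n).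
  exact: (measurableT_comp mstep (pair1_measurable (X w : vec R n))).
have mh : measurable_fun setT (fun v : vec R nw =>
    smooth f N (M *m X w + (c + E *m v))%R).
  exact: (measurableT_comp msm mstepw).
have [mWN WNW] := iid.1 N.
rewrite (ge0_same_law_integral mW' mW W'W mh)//.
rewrite -(ge0_same_law_integral mWN mW WNW mh)//.
have indN := iid_indep_sum iid N measurable_affine.
have mfs := random_vec_forced_sum N.
rewrite /smooth.
have mk : measurable_fun setT (fun p : vec R nw * vec R n =>
    f (M ^+ N *m (M *m X w + (c + E *m p.1)) + p.2)%R).
  apply: (measurableT_comp mf); apply: measurable_vecP => i.
  under eq_fun do rewrite mxE; apply: measurable_funD.
    apply: (measurableT_comp (measurable_entry i)).
    apply: (measurableT_comp (measurable_mulmx _)).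
    exact: (measurableT_comp mstepw measurable_fst).
  exact: (measurableT_comp (measurable_entry i) measurable_snd).
rewrite -(indep_integral mWN mfs indN mk)//.
apply: eq_integral => w2 _ /=; congr f.
rewrite /forced_sum big_ord_recr /= exprSr mulmxDr mulmxA -addrA.
by congr (_ + _)%R; rewrite addrC.
Qed.

Local Close Scope ereal_scope.

Hypothesis sM : schur_stable M.
Variables (m : 'cV[R]_nw) (Xinf : T2 -> 'cV[R]_n).
Hypothesis mXinf : random_vec Pr2 Xinf.
Hypothesis cvgXinf : {ae Pr2, forall w, forall i,
  (fun N => (invmx (1%:M - M) *m (c + E *m m)
     + \sum_(j < N) M ^+ j *m E *m (Wj j w - m)) i 0) @ \oo --> Xinf w i 0}.

(** The forced sum differs from the centred series by a deterministic Neumann series, whose sum is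
    [(1 - M)^-1 (c + E m)]. *)
Lemma forced_sum_cvg : {ae Pr2, forall w, forall i,
  (fun N => forced_sum N w i 0) @ \oo --> Xinf w i 0}.
Proof.
apply: filterS cvgXinf => w H i.
pose b := c + E *m m.
have -> : (fun N => forced_sum N w i 0) = (fun N =>
    (invmx (1%:M - M) *m b + \sum_(j < N) M ^+ j *m E *m (Wj j w - m)) i 0
    + (((\sum_(j < N) M ^+ j) *m b) i 0 - (invmx (1%:M - M) *m b) i 0)).
  apply/funext => N; rewrite [in RHS]mxE.
  have -> : forced_sum N w = (\sum_(j < N) M ^+ j) *m b
      + \sum_(j < N) M ^+ j *m E *m (Wj j w - m).
    rewrite mulmx_suml -big_split /=; apply: eq_bigr => j _.
    by rewrite /b -[X in _ = _ + X]mulmxA -mulmxDr mulmxBr addrACA subrr addr0.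
  rewrite mxE; ring.
rewrite -[X in _ --> X]addr0; apply: cvgD; first exact: H.
rewrite -[X in _ --> X](subrr ((invmx (1%:M - M) *m b) i 0)).
by apply: cvgB; [exact: schur_stable_series_cvg | exact: cvg_cst].
Qed.

(** The left side of [stationary_integral] does not depend on [N]; on the right, dominated
    convergence is used over [Pr2] with [X w] fixed, then over [Pr]. *)
Lemma stationary_same_law : same_law Pr Pr2 X Xinf.
Proof.
apply: test_fun_same_law => // f [mf f01 cf].
have emf : measurable_fun setT (fun v : vec R n => (f v)%:E).
  exact/measurable_EFinP.
have ef0 v : (0 <= (f v)%:E)%E by rewrite lee_fin; case/andP: (f01 v).
pose L := (\int[Pr2]_w (f (Xinf w))%:E)%E.
have inner w : (fun N => \int[Pr2]_w2
    (f (M ^+ N *m X w + forced_sum N w2))%:E)%E @ \oo --> L.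
  apply: (@bounded_cvg_integral _ _ _ Pr2
    (fun N w2 => f (M ^+ N *m X w + forced_sum N w2)) (fun w2 => f (Xinf w2))).
  - move=> N; apply: (measurableT_comp mf).
    apply/(random_vecP Pr2); apply: random_vecD; first exact: random_vec_cst.
    exact: random_vec_forced_sum.
  - by apply: (measurableT_comp mf); exact/(random_vecP Pr2).
  - by move=> N w2; exact: f01.
  - apply: filterS forced_sum_cvg => w2 H; apply: cf => i.
    rewrite -[Xinf w2 i 0]add0r; under eq_fun do rewrite mxE.
    by apply: cvgD; [exact: schur_stable_cvg0 | exact: H].
have innerb N w : (0 <= \int[Pr2]_w2
    (f (M ^+ N *m X w + forced_sum N w2))%:E <= 1)%E.
  rewrite integral_ge0//= -(@probability_setT _ _ _ Pr2).
  rewrite -[leRHS]mul1e -integral_cst//; apply: ge0_le_integral => //.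
    apply: (measurableT_comp emf).
    apply/(random_vecP Pr2); apply: random_vecD; first exact: random_vec_cst.
    exact: random_vec_forced_sum.
  by move=> w2 _; rewrite lee_fin; case/andP: (f01 (M ^+ N *m X w + forced_sum N w2)).
have [] // := @dominated_convergence _ T R Pr setT measurableT
  (fun N w => \int[Pr2]_w2 (f (M ^+ N *m X w + forced_sum N w2))%:E)%E
  (fun=> L) (cst 1%E).
- move=> N; have H := measurable_smooth N emf ef0.
  by apply: (measurableT_comp H); exact/(random_vecP Pr).
- by apply: aeW => w _; exact: inner.
- exact: finite_measure_integrable_cst.
- apply: aeW => w N _ /=; have /andP[h0 h1] := innerb N w.
  by rewrite gee0_abs.
move=> _ _; rewrite integral_cst// [X in (_ * X)%E]probability_setT mule1.
move=> H; apply: (cvg_unique _ _ H) => //.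
rewrite (_ : [sequence _]_n = fun=> \int[Pr]_w (f (X w))%:E)%E.
  exact: cvg_cst.
by apply/funext => N; rewrite [RHS](stationary_integral N emf ef0).
Qed.

End StationaryLaw.

(** * Existence of a stationary law *)

Section WeightedSeries.
Variable R : realType.

(** The cross term obeys [2 s x <= p x^2 + q]: expand [(p x - s)^2 >= 0], use [s^2 <= p q] and
    divide by [p]; if [p = 0] then [s = 0]. *)
Lemma cauchy_schwarz_step (s p q w x : R) : 0 <= p -> 0 <= q -> 0 <= w ->
  s ^+ 2 <= p * q -> (s + w * x) ^+ 2 <= (p + w) * (q + w * x ^+ 2).
Proof.
move=> p0 q0 w0 spq.
have H : 2 * s * x <= p * x ^+ 2 + q.
  have [p_eq0|p_neq0] := eqVneq p 0.
    have /eqP : s ^+ 2 == 0 by rewrite eq_le sqr_ge0 (le_trans spq)// p_eq0 mul0r.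
    by move/eqP; rewrite sqrf_eq0 => /eqP ->; rewrite p_eq0 mulr0 !mul0r add0r.
  have pp : 0 < p by rewrite lt0r p_neq0.
  rewrite -subr_ge0 -(pmulr_rge0 _ pp).
  have := sqr_ge0 (p * x - s); nra.
have := mulr_ge0 w0 (_ : 0 <= p * x ^+ 2 + q - 2 * s * x); rewrite subr_ge0 => /(_ H).
nra.
Qed.

Lemma weighted_cauchy_schwarz (p y : nat -> R) N : (forall j, 0 <= p j) ->
  (\sum_(j < N) p j * y j) ^+ 2 <=
  (\sum_(j < N) p j) * (\sum_(j < N) p j * y j ^+ 2).
Proof.
move=> p0; elim: N => [|N IH]; first by rewrite !big_ord0 expr0n mulr0.
rewrite !big_ord_recr /=; apply: cauchy_schwarz_step => //.
  by rewrite sumr_ge0.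
by rewrite sumr_ge0// => j _; rewrite mulr_ge0// sqr_ge0.
Qed.

Lemma geom_sum_le (rho : R) N : 0 < rho -> rho < 1 ->
  \sum_(j < N) rho ^+ j <= (1 - rho)^-1.
Proof.
move=> r0 r1; have r1' : 0 < 1 - rho by rewrite subr_gt0.
rewrite -[leRHS]mul1r ler_pdivlMr// mulrC.
have <- : 1 - rho ^+ N = (1 - rho) * (\sum_(j < N) rho ^+ j).
  by rewrite -opprB subrX1 -mulNr opprB.
by rewrite gerBl exprn_ge0// ltW.
Qed.

Variables (C rho K : R) (a b : nat -> R).
Hypotheses (C0 : 0 <= C) (r0 : 0 < rho) (r1 : rho < 1).
Hypothesis b0 : forall j, 0 <= b j.
Hypothesis ab : forall j, `|a j| <= C * rho ^+ j * b j.
Hypothesis bK : forall N, \sum_(j < N) rho ^+ j * b j ^+ 2 <= K.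

(** Comparison through [b <= 1 + b^2], which leaves a geometric series and the one bounded by
    [K]. *)
Lemma geom_weighted_series_cvg : cvgn (fun N => \sum_(j < N) a j).
Proof.
rewrite (_ : (fun N => _) = series a); last first.
  by apply/funext => N; rewrite /series /= big_mkord.
have pge0 j : 0 <= rho ^+ j by rewrite exprn_ge0// ltW.
apply: normed_cvg; apply: (@series_le_cvg _ _
    (fun j => C * (rho ^+ j + rho ^+ j * b j ^+ 2))).
- by move=> j /=.
- by move=> j /=; rewrite mulr_ge0// addr_ge0// mulr_ge0// sqr_ge0.
- move=> j /=; apply: (le_trans (ab j)); rewrite -mulrA ler_wpM2l//.
  rewrite -[X in _ <= X + _]mulr1 -mulrDr ler_wpM2l//.
  by have := sqr_ge0 (b j - 1); have := b0 j; nra.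
apply: nondecreasing_is_cvgn.
  apply/nondecreasing_seqP => N; rewrite /series /= big_nat_recr//= lerDl.
  by rewrite mulr_ge0// addr_ge0// mulr_ge0// sqr_ge0.
exists (C * ((1 - rho)^-1 + K)) => _ [N _ <-].
rewrite /series /= big_mkord -mulr_sumr ler_wpM2l// big_split /= lerD//.
  exact: geom_sum_le.
exact: bK.
Qed.

(** Cauchy-Schwarz with weights [rho^j]. The bound is linear in [K], so it stays integrable when [K]
    becomes a random variable of finite mean. *)
Lemma geom_weighted_series_bound N :
  (\sum_(j < N) a j) ^+ 2 <= C ^+ 2 * (1 - rho)^-1 * K.
Proof.
have pge0 j : 0 <= rho ^+ j by rewrite exprn_ge0// ltW.
apply: (@le_trans _ _ ((C * \sum_(j < N) rho ^+ j * b j) ^+ 2)).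
  rewrite -real_normK ?num_real// lerXn2r ?nnegrE//.
    by rewrite mulr_ge0// sumr_ge0// => j _; rewrite mulr_ge0.
  rewrite (le_trans (ler_norm_sum _ _ _))// mulr_sumr ler_sum// => j _.
  by rewrite mulrA.
rewrite exprMn -mulrA ler_wpM2l ?sqr_ge0//.
rewrite (le_trans (weighted_cauchy_schwarz _ _ pge0))//.
rewrite ler_pM ?sumr_ge0//; last exact: geom_sum_le.
by move=> j _; rewrite mulr_ge0// sqr_ge0.
Qed.

Lemma geom_weighted_series_lim_bound :
  (limn (fun N => \sum_(j < N) a j)) ^+ 2 <= C ^+ 2 * (1 - rho)^-1 * K.
Proof.
have c := geom_weighted_series_cvg.
have c2 : (fun N => (\sum_(j < N) a j) ^+ 2) @ \oo -->
    (limn (fun N => \sum_(j < N) a j)) ^+ 2.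
  by under eq_fun do rewrite expr2; rewrite expr2; exact: cvgM.
rewrite -(cvg_lim _ c2)//; apply: limr_le; first by apply/cvg_ex; eexists; exact: c2.
by apply: nearW => N; exact: geom_weighted_series_bound.
Qed.

End WeightedSeries.

Section InfiniteProductIntegral.
Context d (T : measurableType d) (R : realType) (P : probability T R).
Local Open Scope ereal_scope.

Lemma ge0_integral_scons (g : seq_space T -> \bar R) :
  measurable_fun setT g -> (forall w, 0 <= g w) ->
  \int[infprod P]_w g w = \int[P]_w0 \int[infprod P]_w g (scons (w0, w)).
Proof.
move=> mg g0.
have mgs := measurableT_comp mg (@measurable_scons _ T).
transitivity (\int[product_probability P (infprod P)]_p g (scons p)).
  rewrite -(ge0_integral_image_probability _ (@measurable_scons _ T) mg g0).
  by apply: eq_measure_integral => A mA _; apply/esym; exact: infprod_scons.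
by rewrite fubini_tonelli1.
Qed.

Lemma ge0_integral_coord (h : T -> \bar R) j :
  measurable_fun setT h -> (forall x, 0 <= h x) ->
  \int[infprod P]_w h (w j) = \int[P]_x h x.
Proof.
move=> mh h0.
have mhj k := measurableT_comp mh (@measurable_coord _ T k).
elim: j => [|j IH]; rewrite (ge0_integral_scons (mhj _))//=.
  apply: eq_integral => x _.
  by rewrite integral_cst// [X in _ * X]probability_setT mule1.
under eq_integral do rewrite IH.
by rewrite integral_cst// [X in _ * X]probability_setT mule1.
Qed.

End InfiniteProductIntegral.

(** * The series driven by the infinite product *)

Section StationaryProcess.
Variables (R : realType) (n nw : nat).
Variables (M : 'M[R]_n) (c : 'cV[R]_n) (E : 'M[R]_(n, nw)).
Hypothesis sM : schur_stable M.
Context dW (TW : measurableType dW) (PW : probability TW R).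
Variable W : TW -> 'cV[R]_nw.
Hypothesis LW : L2vec PW W.

Let mu := infprod PW.
Let input (x : TW) : 'cV[R]_n := c + E *m W x.
Let size_in (x : TW) : R := \sum_i `|input x i 0|.

Let Linput : L2vec PW input.
Proof. by apply: L2vecD; [exact: L2vec_cst | exact: L2vecM]. Qed.

Definition partial_state N (w : seq_space TW) : 'cV[R]_n :=
  \sum_(j < N) M ^+ j *m input (w j).

(* The [limsup] makes the limit state measurable everywhere; it is the actual
   limit almost surely. *)
Definition limit_state (w : seq_space TW) : 'cV[R]_n :=
  \col_i fine (limn_esup (fun N => (partial_state N w i 0)%:E)).

Lemma random_vec_partial_state N : random_vec mu (partial_state N).
Proof.
apply: random_vec_sum => j; apply: random_vecM => i.
exact: (measurableT_comp (Linput.1 i) (@measurable_coord _ TW j)).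
Qed.

Lemma random_vec_limit_state : random_vec mu limit_state.
Proof.
move=> i.
have -> : (fun w => limit_state w i 0) = fine \o
    (fun w => limn_esup (fun N => (partial_state N w i 0)%:E)).
  by apply/funext => w; rewrite mxE.
apply: (measurableT_comp (@fine_measurable R setT measurableT)).
apply: measurable_fun_limn_esup => N; apply/measurable_EFinP.
exact: random_vec_partial_state.
Qed.

Lemma limit_stateE w (l : 'cV[R]_n) :
  (forall i, (fun N => partial_state N w i 0) @ \oo --> l i 0) ->
  limit_state w = l.
Proof.
move=> wl; apply/colP => i; rewrite mxE.
have H : (fun N => (partial_state N w i 0)%:E) @ \oo --> (l i 0)%:E.
  by apply: cvg_EFin; [exact: nearW | exact: wl].
by rewrite is_cvg_limn_esupE ?(cvg_lim _ H)//; apply/cvg_ex; exists (l i 0)%:E.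
Qed.

Lemma partial_state_scons x w N :
  partial_state N.+1 (scons (x, w)) = input x + M *m partial_state N w.
Proof.
rewrite /partial_state big_ord_recl /= expr0 mul1mx; congr (_ + _).
by rewrite mulmx_sumr; apply: eq_bigr => j _; rewrite exprS mulmxA.
Qed.

Definition state_cvg w := forall i,
  (fun N => partial_state N w i 0) @ \oo --> limit_state w i 0.

Lemma limit_state_scons x w : state_cvg w ->
  limit_state (scons (x, w)) = input x + M *m limit_state w.
Proof.
move=> cw; apply: limit_stateE => i; rewrite -cvg_shiftS /=.
under eq_fun do rewrite partial_state_scons mxE [X in _ + X]mxE.
rewrite [(_ + _ *m _) i 0]mxE; apply: cvgD; first exact: cvg_cst.
rewrite mxE.
have cvgs (I : Type) (s : seq I) (f : I -> nat -> R) (g : I -> R) :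
    (forall k, f k @ \oo --> g k) ->
    (fun N => \sum_(k <- s) f k N) @ \oo --> \sum_(k <- s) g k.
  move=> fg; elim: s => [|k s IH].
    by rewrite big_nil; under eq_fun do rewrite big_nil; exact: cvg_cst.
  rewrite big_cons; under eq_fun do rewrite big_cons.
  by apply: cvgD.
by apply: cvgs => k; apply: cvgMl_tmp; exact: cw.
Qed.

Let C := sval (cid (schur_stable_decay sM)).
Let rho := sval (cid (svalP (cid (schur_stable_decay sM)))).
Let decay : [/\ 0 <= C, 0 < rho, rho < 1 &
      forall N i j, `|(M ^+ N) i j| <= C * rho ^+ N] :=
  svalP (cid (svalP (cid (schur_stable_decay sM)))).

(** The random version of the bound [K]. Its mean is finite, hence it is almost surely finite, and
    it controls both the convergence of the series and the square of its limit. *)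
Let weight (w : seq_space TW) : \bar R :=
  (\sum_(0 <= j <oo) (rho ^+ j * size_in (w j) ^+ 2)%:E)%E.

Let size_in0 x : 0 <= size_in x. Proof. by rewrite sumr_ge0. Qed.

Let weight_term_ge0 w j : (0 <= (rho ^+ j * size_in (w j) ^+ 2)%:E)%E.
Proof.
have [_ r0 _ _] := decay.
by rewrite lee_fin mulr_ge0 ?sqr_ge0// exprn_ge0// ltW.
Qed.

Let L1_size : L1 PW (fun x => size_in x ^+ 2).
Proof.
rewrite (_ : (fun x => _) = fun x => \sum_i \sum_j `|input x i 0 * input x j 0|).
  apply: L1_sum => i; apply: L1_sum => j.
  exact: integrable_norm (L2_L1M i j Linput Linput).
apply/funext => x; rewrite expr2 mulr_suml; apply: eq_bigr => i _.
by rewrite mulr_sumr; apply: eq_bigr => j _; rewrite normrM.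
Qed.

Let measurable_term j : measurable_fun setT
  (fun w : seq_space TW => (rho ^+ j * size_in (w j) ^+ 2)%:E).
Proof.
apply/measurable_EFinP; apply: measurable_funM; first exact: measurable_cst.
exact: (measurableT_comp (L1_measurable L1_size) (@measurable_coord _ TW j)).
Qed.

Let measurable_weight : measurable_fun setT weight.
Proof.
by apply: ge0_emeasurable_sum => // j w _ _; exact: weight_term_ge0.
Qed.

Let weight_ge0 w : (0 <= weight w)%E.
Proof. by apply: nneseries_ge0 => j _ _; exact: weight_term_ge0. Qed.

Let weight_lty : (\int[mu]_w weight w < +oo)%E.
Proof.
have [_ r0 r1 _] := decay.
rewrite integral_nneseries//.
pose k := Ex PW (fun x => size_in x ^+ 2).
have k0 : 0 <= k by apply: Ex_ge0 => x; exact: sqr_ge0.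
apply: (@le_lt_trans _ _ ((k * (1 - rho)^-1)%:E)); last exact: ltry.
apply: lime_le.
  apply: is_cvg_nneseries => j _ _; apply: integral_ge0 => w _.
  exact: weight_term_ge0.
apply: nearW => N; rewrite big_mkord.
have -> : (\sum_(j < N) \int[mu]_w (rho ^+ j * size_in (w j) ^+ 2)%:E)%E =
    (\sum_(j < N) rho ^+ j * k)%:E.
  rewrite -sumEFin; apply: eq_bigr => j _.
  rewrite (ge0_integral_coord PW j (h := fun x => (rho ^+ j * size_in x ^+ 2)%:E)).
  - by rewrite L1_EFin ?ExZ//; exact: L1Z.
  - by apply/measurable_EFinP; exact: (L1_measurable (L1Z _ L1_size)).
  - by move=> x; rewrite lee_fin mulr_ge0 ?sqr_ge0// exprn_ge0// ltW.
by rewrite lee_fin -mulr_suml mulrC ler_wpM2l// geom_sum_le.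
Qed.

Let weight_fin : {ae mu, forall w, weight w \is a fin_num}.
Proof.
have := @integrable_ae _ _ _ mu setT measurableT weight.
have iw : mu.-integrable setT weight.
  apply/integrableP; split => //.
  by under eq_integral do rewrite gee0_abs//.
by move=> /(_ iw); apply: filterS => w; apply.
Qed.

Let term_bound w i j : `|(M ^+ j *m input (w j)) i 0| <= C * rho ^+ j * size_in (w j).
Proof.
have [C0 r0 _ H] := decay.
rewrite mxE (le_trans (ler_norm_sum _ _ _))// mulr_sumr ler_sum// => k _.
by rewrite normrM ler_wpM2r.
Qed.

Let weight_partial w N : weight w \is a fin_num ->
  \sum_(j < N) rho ^+ j * size_in (w j) ^+ 2 <= fine (weight w).
Proof.
move=> wf; rewrite -lee_fin fineK// -sumEFin -(big_mkord xpredT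
  (fun j => (rho ^+ j * size_in (w j) ^+ 2)%:E)).
by apply: nneseries_lim_ge => j _ _; exact: weight_term_ge0.
Qed.

Let good_state w : weight w \is a fin_num -> state_cvg w /\
  forall i, limit_state w i 0 ^+ 2 <= C ^+ 2 * (1 - rho)^-1 * fine (weight w).
Proof.
move=> wf; have [C0 r0 r1 _] := decay.
have psE N i : partial_state N w i 0 = \sum_(j < N) (M ^+ j *m input (w j)) i 0.
  by rewrite /partial_state summxE.
have cw i := geom_weighted_series_cvg C0 r0 r1 (fun j => size_in0 (w j))
  (term_bound w i) (fun N => weight_partial N wf).
have lE : limit_state w =
    \col_i limn (fun N => \sum_(j < N) (M ^+ j *m input (w j)) i 0).
  apply: limit_stateE => i; rewrite mxE; under eq_fun do rewrite psE.
  exact: cw.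
split=> i.
  by rewrite lE mxE; under eq_fun do rewrite psE; exact: cw.
rewrite lE mxE; exact: (geom_weighted_series_lim_bound C0 r0 r1
  (fun j => size_in0 (w j)) (term_bound w i) (fun N => weight_partial N wf)).
Qed.

Lemma ae_state_cvg : {ae mu, forall w, state_cvg w}.
Proof. by apply: filterS weight_fin => w /good_state[]. Qed.

Lemma L2vec_limit_state : L2vec mu limit_state.
Proof.
have [C0 r0 r1 _] := decay.
split=> [|i]; first exact: random_vec_limit_state.
have mX : measurable_fun setT (fun w => ((limit_state w i 0) ^+ 2)%:E).
  by apply/measurable_EFinP; apply: measurable_funX; exact: random_vec_limit_state.
apply/integrableP; split=> //.
pose k := C ^+ 2 * (1 - rho)^-1.
have k0 : 0 <= k by rewrite mulr_ge0 ?sqr_ge0// invr_ge0 subr_ge0 ltW.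
apply: (@le_lt_trans _ _ (\int[mu]_w (k%:E * weight w))%E).
  apply: ae_ge0_le_integral => //.
  - exact: measurableT_comp.
  - by move=> w _; rewrite mule_ge0 ?lee_fin.
  - exact: measurable_funeM.
  - apply: filterS weight_fin => w wf _.
    rewrite gee0_abs ?lee_fin ?sqr_ge0// -(fineK wf) -EFinM lee_fin.
    by have [_] := good_state wf; apply.
by rewrite ge0_integralZl// lte_mul_pinfty.
Qed.

End StationaryProcess.

(** * Optimal stationary pairs *)

Lemma ae_eq_same_law (R : realType) d (T : measurableType d)
    (Pr : probability T R) n (X Y : T -> 'cV[R]_n) :
  random_vec Pr X -> random_vec Pr Y -> {ae Pr, forall w, X w = Y w} ->
  same_law Pr Pr X Y.
Proof.
move=> /random_vecP mX /random_vecP mY XY S mS.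
have mXS : measurable (X @^-1` S) by rewrite -[X in measurable X]setTI; exact: mX.
have mYS : measurable (Y @^-1` S) by rewrite -[X in measurable X]setTI; exact: mY.
rewrite -[X @^-1` S]setIT -[Y @^-1` S]setIT -!integral_indic//.
apply: ae_eq_integral => //.
- by apply/measurable_EFinP; exact: measurable_indic.
- by apply/measurable_EFinP; exact: measurable_indic.
apply: filterS XY => w XYw _; rewrite !indicE; congr ((nat_of_bool _)%:R)%:E.
by apply/idP/idP; rewrite !inE /= XYw.
Qed.

Lemma same_law_trans (R : realType) n
    d1 (T1 : measurableType d1) (Pr1 : probability T1 R)
    d2 (T2 : measurableType d2) (Pr2 : probability T2 R)
    d3 (T3 : measurableType d3) (Pr3 : probability T3 R)
    (X : T1 -> 'cV[R]_n) (Y : T2 -> 'cV[R]_n) (Z : T3 -> 'cV[R]_n) :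
  same_law Pr1 Pr2 X Y -> same_law Pr2 Pr3 Y Z -> same_law Pr1 Pr3 X Z.
Proof. by move=> XY YZ S mS; rewrite XY// YZ. Qed.

Lemma ae_product_snd (R : realType) d1 (T1 : measurableType d1)
    (P1 : probability T1 R) d2 (T2 : measurableType d2) (P2 : probability T2 R)
    (H : T2 -> Prop) : {ae P2, forall w, H w} ->
  {ae product_probability P1 P2, forall p, H p.2}.
Proof.
move=> [N [mN N0 HN]]; exists (setT `*` N); split.
- exact: measurableX.
- have H0 := product_measure1E P1 P2 (@measurableT _ T1) mN.
  by rewrite [X in (_ * X)%E]N0 mule0 in H0.
- by move=> p np; split => //; exact: HN.
Qed.

Section Attainment.
Variables (R : realType) (nx nu nw : nat).
Variables (A : 'M[R]_nx) (B : 'M[R]_(nx, nu)) (E : 'M[R]_(nx, nw)).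
Variables (K : 'M[R]_(nu, nx)) (f : 'cV[R]_nu).
Hypothesis sM : schur_stable (A + B *m K).
Context dW (TW : measurableType dW) (PW : probability TW R).
Variable W : TW -> 'cV[R]_nw.
Hypothesis LW : L2vec PW W.

(** On the product of [TW] with its sequences, [W'] reads the head and [X] only the tail, which
    makes them independent. *)
Lemma affine_feedback_feasible : exists (d : measure_display) (T : measurableType d)
    (Pr : probability T R) (X : T -> 'cV[R]_nx),
  stat_feasible A B E PW W Pr X (fun w => K *m X w + f).
Proof.
pose mu := infprod PW; pose Pr := product_probability PW mu.
pose M := A + B *m K.
pose Xi := limit_state M (B *m f) E W.
have LXi : L2vec mu Xi := L2vec_limit_state (B *m f) E sM LW.
have mXi := (random_vecP mu Xi).1 LXi.1.
pose X (p : TW * seq_space TW) := Xi p.2.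
have prodE S S' : measurable S -> measurable S' ->
    Pr (fst @^-1` S `&` snd @^-1` S') = (PW S * mu S')%E.
  move=> mS mS'; exact: (product_measure1E PW mu mS mS').
have XXi : same_law Pr mu X Xi.
  move=> S mS; have mS' : measurable (Xi @^-1` S).
    by rewrite -[X in measurable X]setTI; exact: mXi.
  have := prodE setT _ measurableT mS'.
  by rewrite preimage_setT setTI [X in (X * _)%E]probability_setT mul1e.
have mX : random_vec Pr X by move=> i; exact: (measurableT_comp (LXi.1 i) measurable_snd).
have LX : L2vec Pr X := same_law_L2 mX XXi LXi.
have mW' : random_vec Pr (W \o fst).
  by move=> i; exact: (measurableT_comp (LW.1 i) measurable_fst).
have mWv := (random_vecP PW W).1 LW.1.
exists _, _, Pr, X; split=> //; split.
  by apply: L2vecD; [exact: L2vecM | exact: L2vec_cst].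
exists (W \o fst); split=> //; split; [|split].
- move=> S mS; have mS' : measurable (W @^-1` S).
    by rewrite -[X in measurable X]setTI; exact: mWv.
  have := prodE _ setT mS' measurableT.
  by rewrite preimage_setT setIT [X in (_ * X)%E]probability_setT mule1.
- apply: indep_vec_sym => S S' mS mS'.
  pose Y w := col_mx (Xi w) (K *m Xi w + f).
  have mY : measurable_fun setT (Y : seq_space TW -> vec R (nx + nu)).
    apply/(random_vecP mu); apply: random_vec_col; first exact: LXi.1.
    by apply: random_vecD; [apply: random_vecM; exact: LXi.1 | exact: random_vec_cst].
  have m1 : measurable (W @^-1` S).
    by rewrite -[X in measurable X]setTI; exact: mWv.
  have m2 : measurable (Y @^-1` S').
    by rewrite -[X in measurable X]setTI; exact: mY.
  have e1 := prodE _ setT m1 measurableT.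
  have e2 := prodE setT _ measurableT m2.
  rewrite preimage_setT setIT [X in (_ * X)%E]probability_setT mule1 in e1.
  rewrite preimage_setT setTI [X in (X * _)%E]probability_setT mul1e in e2.
  rewrite [X in (X * _)%E](_ : _ = PW (W @^-1` S))//.
  rewrite [X in (_ * X)%E](_ : _ = mu (Y @^-1` S'))//.
  exact: (prodE _ _ m1 m2).
(* The series of the sequence with its head put back: it has the law of [Xi] by [infprod_scons], and
   almost surely it is the successor of [X]. *)
- pose X1 (p : TW * seq_space TW) := Xi (scons p).
  have mX1 : random_vec Pr X1.
    by move=> i; exact: (measurableT_comp (LXi.1 i) (@measurable_scons _ TW)).
  have XiX1 : same_law mu Pr Xi X1.
    move=> S mS; have mS' : measurable (Xi @^-1` S).
      by rewrite -[X in measurable X]setTI; exact: mXi.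
    exact/esym/(infprod_scons PW mS').
  apply: (same_law_trans XXi); apply: (same_law_trans XiX1).
  apply: ae_eq_same_law => //.
    apply: random_vecD; last exact: random_vecM.
    apply: random_vecD; first exact: random_vecM.
    apply: random_vecM; apply: random_vecD; [exact: random_vecM | exact: random_vec_cst].
  apply: filterS (ae_product_snd PW (ae_state_cvg (B *m f) E sM LW)).
  move=> -[x w] /= cw; rewrite /X1 /Xi (limit_state_scons x cw) /X /=.
  by rewrite -/Xi /M mulmxDl mulmxDr -[B *m K *m _]mulmxA [LHS]addrC !addrA.
Qed.

End Attainment.

Lemma pd_ge0 (R : realType) n (M : 'M[R]_n) z : pd M -> 0 <= qform M z.
Proof.
move=> [_ pM]; have [->|z0] := eqVneq z 0; last exact/ltW/pM.
by rewrite /qform mulmx0 mxE.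
Qed.

Lemma indep_vec_usubmx (R : realType) d (T : measurableType d)
    (Pr : probability T R) n p m (X : T -> 'cV[R]_n) (U : T -> 'cV[R]_p)
    (Z : T -> 'cV[R]_m) :
  indep_vec Pr (fun w => col_mx (X w) (U w)) Z -> indep_vec Pr X Z.
Proof.
move=> XUZ S S' mS mS'.
have mu : measurable_fun setT (@usubmx R n p 1 : vec R (n + p) -> vec R n).
  apply: measurable_vecP => i; under eq_fun do rewrite mxE.
  exact: measurable_entry.
have := mu measurableT S mS; rewrite setTI => mS2.
have := XUZ _ _ mS2 mS'.
rewrite (_ : (fun w => col_mx (X w) (U w)) @^-1` (usubmx @^-1` S) = X @^-1` S)//.
by apply/seteqP; split => w /=; rewrite col_mxKu.
Qed.

Theorem theorem2 (R : realType) (nx nu nw : nat)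
  (A : 'M[R]_nx) (B : 'M[R]_(nx, nu)) (E : 'M[R]_(nx, nw))
  (Q : 'M[R]_nx) (Rm : 'M[R]_nu)
  (hQ : psd Q) (hR : pd Rm)
  (hstab : stabilizable A B) (hdet : detectable_sqrt A Q)
  (dW : measure_display) (TW : measurableType dW) (PW : probability TW R)
  (W : TW -> 'cV[R]_nw) (hW : L2vec PW W)
  (P : 'M[R]_nx) (hP : stabilizing_dare_sol A B Q Rm P)
  (G : 'M[R]_(nx, nw))
  (hG : G = (A + B *m lqK A B Rm P)^T *m (P *m E + G)) :
  let K := lqK A B Rm P in
  let At := A + B *m K in
  let F := lqF B E Rm P G in
  let Ft := B *m F + E in
  let EW := mean PW W in
  let cstar : \bar R :=
    (sqnorm PW (E^T *m P *m E) W + (qform (deltaS B E Rm P G) EW)%:E)%E in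
  (* cstar is a lower bound of the cost over all feasible pairs *)
  (forall (d : measure_display) (T : measurableType d) (Pr : probability T R)
     (X : T -> 'cV[R]_nx) (U : T -> 'cV[R]_nu),
     stat_feasible A B E PW W Pr X U ->
     (cstar <= stat_cost Q Rm Pr X U)%E) /\
  (* the minimum cstar is attained *)
  (exists (d : measure_display) (T : measurableType d) (Pr : probability T R)
     (X : T -> 'cV[R]_nx) (U : T -> 'cV[R]_nu),
     stat_feasible A B E PW W Pr X U /\ stat_cost Q Rm Pr X U = cstar) /\
  (* every solution has laws (mu_X^diamond, mu_U^diamond), where mu_X^diamond
     is the law of X_oo := (I - At)^-1 Ft E[W] + sum_j At^j E (W_j - E[W]),
     W_j i.i.d. copies of W, and mu_U^diamond the law of K X_oo + F E[W] *)
  (forall (d : measure_display) (T : measurableType d) (Pr : probability T R)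
     (X : T -> 'cV[R]_nx) (U : T -> 'cV[R]_nu),
     stat_feasible A B E PW W Pr X U -> stat_cost Q Rm Pr X U = cstar ->
     forall (d2 : measure_display) (T2 : measurableType d2)
       (Pr2 : probability T2 R) (Wj : nat -> T2 -> 'cV[R]_nw)
       (Xinf : T2 -> 'cV[R]_nx),
       iid_copies Pr2 PW Wj W ->
       random_vec Pr2 Xinf ->
       {ae Pr2, forall w,
          (fun N : nat => invmx (1%:M - At) *m Ft *m EW
             + \sum_(j < N) At ^+ j *m E *m (Wj j w - EW)) @ \oo --> Xinf w} ->
       same_law Pr Pr2 X Xinf /\
       same_law Pr Pr2 U (fun w => K *m Xinf w + F *m EW)).
Proof.
case: hP => psdP [dareP sM] K At F Ft EW cstar.
have decomp (d : measure_display) (T : measurableType d) (Pr : probability T R)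
    (X : T -> 'cV[R]_nx) (U : T -> 'cV[R]_nu) :
    stat_feasible A B E PW W Pr X U -> stat_cost Q Rm Pr X U =
    (cstar + (Ex Pr (fun w => qform (Rm + B^T *m P *m B)
                (U w - K *m X w - F *m EW)))%:E)%E.
  exact: (stat_cost_dev hR psdP dareP hG hW).
have pdS := pd_lqS B hR psdP.
have S0 z : 0 <= qform (Rm + B^T *m P *m B) z.
  by rewrite -[qform _ _]/(bil _ z z); exact: (pd_ge0 _ pdS).
(* Finiteness allows [cstar] to be cancelled in [costE]. *)
have cfin : cstar \is a fin_num.
  by rewrite /cstar sqnormE.
split; [|split].
- move=> d T Pr X U /decomp ->.
  by rewrite leeDl// lee_fin; apply: Ex_ge0 => w; exact: S0.
- have [d [T [Pr [X fX]]]] := affine_feedback_feasible E (F *m EW) sM hW.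
  exists d, T, Pr, X, (fun w => K *m X w + F *m EW); split=> //.
  rewrite (decomp _ _ _ _ _ fX).
  under [X in Ex _ X]eq_fun => w.
    rewrite [K *m X w + _]addrC addrK subrr /qform mulmx0 mxE.
    over.
  by rewrite Ex_cst adde0.
move=> d T Pr X U fXU cost d2 T2 Pr2 Wj Xinf iid mXinf cvgX.
have [LX [LU [W' [mW' [W'W [ind law]]]]]] := fXU.
have := decomp _ _ _ _ _ fXU; rewrite cost => costE.
have Ldev : L2vec Pr (fun w => U w - K *m X w - F *m EW).
  exact: (L2_lqdev _ _ _ _ _ _ _ _ LX LU).
(* A nonnegative function of mean zero vanishes almost everywhere, and definiteness passes from the
   form to the vector. *)
have dev0 : {ae Pr, forall w, U w = K *m X w + F *m EW}.
  have : {ae Pr, forall w, qform (Rm + B^T *m P *m B)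
      (U w - K *m X w - F *m EW) = 0}.
    apply: Ex_eq0 => //; first exact: (L1_bil _ Ldev Ldev).
    move: costE; rewrite -(fineK cfin) -EFinD => -[].
    by move=> /eqP; rewrite addrC -subr_eq subrr => /eqP <-.
  apply: filterS => w dev0; apply/eqP; rewrite -subr_eq0 opprD addrA.
  by apply/negPn/negP => nz; have := pdS.2 _ nz; rewrite dev0 ltxx.
pose c := B *m (F *m EW).
have mstep : random_vec Pr (fun w => At *m X w + (c + E *m W' w)).
  apply: random_vecD; first exact: (random_vecM At LX.1).
  by apply: random_vecD; [exact: random_vec_cst | exact: random_vecM].
have mdyn : random_vec Pr (fun w => A *m X w + B *m U w + E *m W' w).
  apply: random_vecD; last exact: random_vecM.
  by apply: random_vecD; [exact: (random_vecM A LX.1) | exact: (random_vecM B LU.1)].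
have statX : same_law Pr Pr X (fun w => At *m X w + (c + E *m W' w)).
  apply: (same_law_trans law); apply: ae_eq_same_law => //.
  apply: filterS dev0 => w ->.
  by rewrite /At /c mulmxDl mulmxDr -[B *m K *m _]mulmxA !addrA.
have lawX : same_law Pr Pr2 X Xinf.
  apply: (stationary_same_law hW.1 LX.1 mW' W'W (indep_vec_usubmx ind) statX iid
    sM (m := EW) mXinf).
  (* The given convergence is that of vectors; continuity of the coordinates yields the entrywise
     one. *)
  apply: filterS cvgX => w cw i.
  have H : (fun N => (invmx (1%:M - At) *m Ft *m EW
      + \sum_(j < N) At ^+ j *m E *m (Wj j w - EW)) i 0) @ \oo --> Xinf w i 0.
    exact: (cvg_comp _ _ cw (@coord_continuous R nx 1 i 0 (Xinf w))).
  have bE : Ft *m EW = c + E *m EW by rewrite /Ft mulmxDl /c !mulmxA.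
  by rewrite -bE mulmxA.
split=> //.
have maff : measurable_fun setT (fun v : vec R nx => K *m v + F *m EW : vec R nu).
  apply: measurable_vecP => i; under eq_fun do rewrite mxE.
  apply: measurable_funD; last exact: measurable_cst.
  exact: (measurableT_comp (measurable_entry i) (measurable_mulmx K)).
apply: (same_law_trans (Y := fun w => K *m X w + F *m EW)).
  apply: ae_eq_same_law => //; first exact: LU.1.
  by apply: random_vecD; [exact: (random_vecM K LX.1) | exact: random_vec_cst].
exact: (same_law_comp maff lawX).
Qed.
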